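(* Let $\mathcal F$ be a collection of symmetric measurable functions $f:S^r\to\mathbb R$ with a measurable envelope $F:S^r\to[0,\infty)$ such that $0<P^rF^2<\infty$. Let $M\ge1$ and $0<N\le|I_{n,r}|$ be integers, $p_n=N/|I_{n,r}|$, and let $\{Z_\iota^{(m)}:\iota\in I_{n,r},m\in[M]\}$ be i.i.d. Bernoulli$(p_n)$ random variables independent of the data $X_1,\dots,X_n$. For $m\in[M]$ and $f\in\mathcal F$ let $$\mathbb D_n^{(m)}(f):=\frac1{\sqrt N}\sum_{\iota\in I_{n,r}}(Z_\iota^{(m)}-p_n)f(X_\iota).$$ Let $\sigma_r>0$ be such that $\sup_{f\in\mathcal F}\|f\|_{P^r,2}\le\sigma_r\le\|F\|_{P^r,2}$, and define $$\delta_r:=\frac{\sigma_r}{\sqrt M\|F\|_{P^r,2}},\qquad \Delta:=\mathbb E\Big[\sup_{f\in\mathcal F}|I_{n,r}|^{-1}\sum_{\iota\in I_{n,r}}f^2(X_\iota)\Big],\qquad\widetilde{\mathcal T}:=\max_{\iota\in I_{n,r},\,m\in[M]}Z_\iota^{(m)}F(X_\iota).$$ Then for some absolute constant $C>0$, $$C^{-1}\,\mathbb E\Big[\max_{m\in[M]}\|\mathbb D_n^{(m)}(f)\|_{\mathcal F}\Big]\le\sqrt{M\log(2M)}\,\bar J(\delta_r)\|F\|_{P^r,2}+\frac{\log(2M)\|\widetilde{\mathcal T}\|_{\mathbb P,2}}{\sqrt N}\frac{\bar J^2(\delta_r)}{\delta_r^2}+\sqrt{\Delta\log(2M)}\,\frac{\bar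 J(\delta_r)}{\delta_r}.$$ Further, $\|\widetilde{\mathcal T}\|_{\mathbb P,2}\le M^{1/q}N^{1/q}\|F\|_{P^r,q}$ for any $q\in[2,\infty]$, with $1/q=0$ if $q=\infty$. In addition, if $\mathcal F$ (with envelope $F$) is a VC type class with characteristics $(A,\nu)$, where $A\ge e\vee(e^{2(r-1)}/16)$ and $\nu\ge1$, then $\bar J(\tau)\le C\tau\sqrt{\nu\log(A/\tau)}$ for $\tau\in(0,1]$.
   Context: $r\ge2$; $(S,\mathcal S)$ is a measurable space; $X_1,\dots,X_n$ are i.i.d. $S$-valued with law $P$; $I_{n,r}=\{(i_1,\dots,i_r):1\le i_1<\dots<i_r\le n\}$, $X_\iota=(X_{i_1},\dots,X_{i_r})$. $F$ is an envelope of $\mathcal F$ if $F\ge\sup_{f\in\mathcal F}|f|$ pointwise. $\|\cdot\|_{\mathcal F}=\sup_{f\in\mathcal F}|\cdot|$; $\|\cdot\|_{Q,q}$ is the $L^q(Q)$ (semi)norm; $\|\widetilde{\mathcal T}\|_{\mathbb P,2}=(\mathbb E\widetilde{\mathcal T}^2)^{1/2}$. Uniform entropy integral: for $\tau>0$, $\bar J(\tau)=\bar J(\tau,\mathcal F,F)=\int_0^\tau\sqrt{1+\sup_Q\log N(\mathcal F,\|\cdot\|_{Q,2},\epsilon\|F\|_{Q,2})}\,d\epsilon$, with $\sup_Q$ over finitely supported probability measures on $S^r$ and $N(T,d,\epsilon)$ the $\epsilon$-covering number (minimal number of closed $d$-balls of radius $\epsilon$ covering $T$). VC type with characteristics $(A,\nu)$: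 $\sup_QN(\mathcal F,\|\cdot\|_{Q,2},\epsilon\|F\|_{Q,2})\le(A/\epsilon)^\nu$ for all $\epsilon\in(0,1)$, the supremum over finitely discrete probability measures on $S^r$. *)

(* Defs.v *)
From HB Require Import structures.
From mathcomp Require Import all_boot all_order all_algebra all_fingroup.
From mathcomp Require Import all_classical all_reals all_analysis.
From mathcomp Require Import measurable_realfun.

Set Implicit Arguments.
Unset Strict Implicit.
Unset Printing Implicit Defensive.

Import Order.TTheory GRing.Theory Num.Theory.
Import numFieldNormedType.Exports.

Local Open Scope classical_set_scope.
Local Open Scope ring_scope.
Local Open Scope ereal_scope.

Section product_power.
Context d (S : measurableType d) (R : realType) (P : probability S R).

Definition tcons n (x : S * n.-tuple S) : n.+1.-tuple S := [tuple of x.1 :: x.2].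

Lemma measurable_tcons n : measurable_fun [set: S * n.-tuple S] (@tcons n).
Proof. exact: measurable_cons. Qed.

HB.instance Definition _ n :=
  isMeasurableFun.Build _ _ _ _ (@tcons n) (@measurable_tcons n).

(* P^n on S^n, the n-fold product being built as P \x P^(n-1). *)
Fixpoint power_prob n : probability (n.-tuple S) R :=
  if n is n'.+1 then distribution (P \x power_prob n') (@tcons n')
  else \d_([tuple] : 0.-tuple S).

Lemma power_prob_box n (A : 'I_n -> set S) : (forall i, measurable (A i)) ->
  power_prob n [set x | forall i, A i (tnth x i)] = \prod_(i < n) P (A i).
Proof.
elim: n A => [|n IHn] A mA.
  rewrite big_ord0 /= (_ : [set _ | _] = setT) ?probability_setT//.
  by apply/seteqP; split => // x _ [].
rewrite big_ord_recl /= /distribution /pushforward /=.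
rewrite (_ : _ @^-1` _ = A ord0 `*`
   [set x : n.-tuple S | forall i, A (lift ord0 i) (tnth x i)]); last first.
  apply/seteqP; split => [[x y] /= h|[x y] /= [h0 h] i].
    split; first by have := h ord0; rewrite tnth0.
    by move=> i; have := h (lift ord0 i); rewrite tnthS.
  by case: (unliftP ord0 i) => [j ->|->]; rewrite ?tnthS ?tnth0.
have mB : measurable [set x : n.-tuple S | forall i, A (lift ord0 i) (tnth x i)].
  rewrite (_ : [set _ | _] = \bigcap_(i in [set: 'I_n])
    ((@tnth n S ^~ i) @^-1` A (lift ord0 i))); last first.
    by apply/seteqP; split => [x h i _|x h i] /=; [exact: h|exact: (h i I)].
  apply: fin_bigcap_measurable => // i _.
  by rewrite -[X in measurable X]setTI; exact: measurable_tnth.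
rewrite product_measure1E//; congr (_ * _).
exact: (IHn (fun i => A (lift ord0 i))).
Qed.

End product_power.

Section independence.
Context d (Omega : measurableType d) (R : realType) (Pr : probability Omega R).

(* Since [I] is finite and each [A i] may be the whole space, the product
   rule over all of [I] contains the one for every subfamily. *)
Definition mutually_independent (I : finType) d' (T : measurableType d')
    (X : I -> {RV Pr >-> T}) :=
  forall A : I -> set T, (forall i, measurable (A i)) ->
    Pr [set w | forall i, A i (X i w)] = \prod_(i : I) Pr (X i @^-1` A i).

Definition sigma_rv (I : Type) d' (T : measurableType d')
    (X : I -> {RV Pr >-> T}) : set (set Omega) :=
  <<s [set B | exists i A, measurable A /\ B = X i @^-1` A] >>.

Definition independent_families (I J : Type) d1 d2
    (T1 : measurableType d1) (T2 : measurableType d2)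
    (X : I -> {RV Pr >-> T1}) (Y : J -> {RV Pr >-> T2}) :=
  forall A B, sigma_rv X A -> sigma_rv Y B -> Pr (A `&` B) = Pr A * Pr B.

End independence.

(* The number of centers is +oo when no finite cover exists; the centers are
   taken in the covered set [A]. *)
Definition covering_number (R : realType) (T : Type) (A : set T)
    (dist : T -> T -> \bar R) (eps : \bar R) : \bar R :=
  ereal_inf [set k%:R%:E | k in [set k : nat | exists c : 'I_k -> T,
    (forall i, A (c i)) /\
    (forall t, A t -> exists i, dist t (c i) <= eps)]].

Definition finitely_supported d (T : measurableType d) (R : realType)
    (Q : probability T R) :=
  exists (k : nat) (w : 'I_k -> R) (x : 'I_k -> T),
    (forall i, (0 <= w i)%R) /\
    forall A, measurable A -> Q A = \sum_(i < k) (w i)%:E * \d_(x i) A.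

Section entropy.
Context d (T : measurableType d) (R : realType).
Implicit Types (FF : set (T -> R)) (F : T -> R).

Definition scaled_covering FF F (Q : probability T R) (eps : R) : \bar R :=
  covering_number FF (fun f g => 'N[Q]_2%:E [EFin \o (f \- g)%R])
    (eps%:E * 'N[Q]_2%:E [EFin \o F]).

Definition Jbar FF F (tau : R) : \bar R :=
  \int[lebesgue_measure]_(eps in `[0%R, tau])
    sqrte (1 + ereal_sup [set lne (scaled_covering FF F Q eps) |
                           Q in @finitely_supported _ T R]).

Definition VC_type FF F (A nu : R) :=
  forall eps : R, (0 < eps < 1)%R ->
    ereal_sup [set scaled_covering FF F Q eps |
                Q in @finitely_supported _ T R] <= ((A / eps) `^ nu)%:E.

End entropy.

(* The index set I_{n,r}, with indices running over 0 <= i_1 < ... < i_r < n. *)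
Definition incr_tuple (n r : nat) :=
  {t : r.-tuple 'I_n | sorted ltn (map val t)}.

Definition subsample (S : Type) (n r : nat) (x : n.-tuple S)
    (i : incr_tuple n r) : r.-tuple S :=
  [tuple tnth x (tnth (val i) k) | k < r].

Definition symmetric_fun (S V : Type) (r : nat) (f : r.-tuple S -> V) :=
  forall (s : 'S_r) (x : r.-tuple S), f [tuple tnth x (s k) | k < r] = f x.

Section incomplete_ustat.
Context (S : Type) (R : realType) (n r M : nat).

Definition samp_prob (N : nat) : R := (N%:R / #|{: incr_tuple n r}|%:R)%R.

(* D_n^(m)(f) for data [x] and Bernoulli variables [z]. *)
Definition Dn (N : nat) (x : n.-tuple S) (z : incr_tuple n r -> 'I_M -> bool)
    (m : 'I_M) (f : r.-tuple S -> R) : R :=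
  ((Num.sqrt N%:R)^-1 *
   \sum_(i : incr_tuple n r) ((z i m)%:R - samp_prob N) * f (subsample x i))%R.

Definition sup_norm (FF : set (r.-tuple S -> R)) (G : (r.-tuple S -> R) -> R)
    : \bar R :=
  ereal_sup [set `|G f|%:E | f in FF].

Definition max_Dn (FF : set (r.-tuple S -> R)) (N : nat) (x : n.-tuple S)
    (z : incr_tuple n r -> 'I_M -> bool) : \bar R :=
  \big[maxe/-oo]_(m < M) sup_norm FF (Dn N x z m).

Definition sup_mean_sqr (FF : set (r.-tuple S -> R)) (x : n.-tuple S) : \bar R :=
  ereal_sup [set (#|{: incr_tuple n r}|%:R^-1 *
     \sum_(i : incr_tuple n r) f (subsample x i) ^+ 2)%R%:E | f in FF].

Definition max_ZF (F : r.-tuple S -> R) (x : n.-tuple S)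
    (z : incr_tuple n r -> 'I_M -> bool) : R :=
  (\big[Num.max/0]_(i : incr_tuple n r) \big[Num.max/0]_(m < M)
     ((z i m)%:R * F (subsample x i)))%R.

End incomplete_ustat.

(* Main.v *)
Require Import Defs.
From HB Require Import structures.
From mathcomp Require Import all_boot all_order all_algebra all_fingroup.
From mathcomp Require Import all_classical all_reals all_analysis.
From mathcomp Require Import measurable_realfun ess_sup_inf.
From mathcomp Require Import ring lra.

Set Implicit Arguments.
Unset Strict Implicit.
Unset Printing Implicit Defensive.

Import Order.TTheory GRing.Theory Num.Theory.
Import numFieldNormedType.Exports.

Local Open Scope classical_set_scope.
Local Open Scope ring_scope.

(** Conditionally on the data, the problem is finite: a function [f] acts only
through its values at the points [X_iota], and the selectors range over a finite
product of Bernoulli laws. The maximal process is therefore bounded for each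
fixed data set, by a quantity that depends on the data only through the envelope,
through the supremum of the empirical second moments, and through the mean square
of [max Z F]; the data are integrated out at the very end. In this way the only
suprema over the class that are ever integrated are those known to be measurable.

For fixed data, [symmetrization] replaces [Z - p] by [eps Z] with independent
signs [eps]. For fixed selectors the signed sums are sub-Gaussian with respect to
the L2 distance of the points selected in all [M] groups together. Normalized,
these points form a finitely supported probability, so the uniform entropy
controls the covering numbers, and dyadic chaining ([chaining_bound]) bounds the
conditional mean by a constant times
[sqrt (ln 2M) * J delta * (G + s / delta)], where [G] is the L2 norm of the
envelope and [s] the largest L2 norm of a function within one group
([rademacher_bound]). Pooling the groups multiplies the mean of [G ^ 2] by [M],
which is where the factor [sqrt M] in [delta] comes from. The bound is affine in
[s] because the integrand of [J] is nonincreasing ([entropy_dyadic_sum]).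

It remains to bound [B = sqrt (E (s ^ 2))]. Centering the selectors,
[s ^ 2 <= N Delta + sup |sum (Z - p) f ^ 2|], and the last process is handled by
the same chaining, since [f ^ 2 - g ^ 2] is bounded by [2 max (Z F) |f - g|]
([rademacher_sqr_bound]). The Cauchy-Schwarz inequality then gives a quadratic
inequality [B ^ 2 <= N Delta + a (delta G + B)] with
[a = c sqrt (ln 2M) * J delta * sqrt (E (max Z F) ^ 2) / delta]. Solving it
([conditional_bound]) produces the three terms of the theorem, which are
integrated over the data with [E (sqrt h) <= sqrt (E h)] ([integral_max_Dn_le]).

The bound on the norm of [max Z F] is monotonicity of the norms in the exponent,
followed by domination of the power of a maximum by the sum of the powers
([integral_max_ZF_powR]). For a class of VC type, [ln (tau / eps)] is at most the
number of dyadic levels [2 ^- k * tau] above [eps], so that the entropy integral is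
bounded by a geometric series ([Jbar_VC]). *)

(** * Finite Bernoulli products *)

Section bernoulli_mean.
Context (R : realType) (K : finType).
Implicit Types (p : R) (h g : {ffun K -> bool} -> R).

Definition bern_weight p (z : {ffun K -> bool}) : R :=
  \prod_k (if z k then p else 1 - p).

(** With [p = 2^-1] and the signs [(-1) ^+ e k], this is also the mean over
Rademacher signs. *)
Definition bern_mean p h : R := \sum_z bern_weight p z * h z.

Lemma bern_weight_ge0 p z : 0 <= p <= 1 -> 0 <= bern_weight p z.
Proof.
by move=> /andP[p0 p1]; apply: prodr_ge0 => k _; case: ifP => _; rewrite ?subr_ge0.
Qed.

(** Independence of the coordinates, as the expansion of a product of two-term
sums over all Boolean functions. *)
Lemma bern_mean_prod p (u : K -> bool -> R) :
  bern_mean p (fun z => \prod_k u k (z k)) =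
  \prod_k (p * u k true + (1 - p) * u k false).
Proof.
transitivity (\prod_k \sum_b (if b then p else 1 - p) * u k b).
  rewrite bigA_distr_bigA/=; apply: eq_bigr => z _.
  by rewrite /bern_weight -big_split.
by apply: eq_bigr => k _; rewrite big_bool.
Qed.

Lemma bern_weight_sum p : \sum_z bern_weight p z = 1.
Proof.
transitivity (bern_mean p (fun=> \prod_(k : K) 1)).
  by apply: eq_bigr => z _; rewrite big1_eq mulr1.
rewrite (bern_mean_prod p (fun _ _ => 1)) big1// => k _.
by rewrite !mulr1 addrC subrK.
Qed.

Lemma bern_meanD p h g :
  bern_mean p (fun z => h z + g z) = bern_mean p h + bern_mean p g.
Proof. by rewrite /bern_mean -big_split/=; apply: eq_bigr => z _; rewrite mulrDr. Qed.

Lemma bern_meanZ p c h : bern_mean p (fun z => c * h z) = c * bern_mean p h.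
Proof. by rewrite /bern_mean mulr_sumr; apply: eq_bigr => z _; rewrite mulrCA. Qed.

Lemma bern_mean_cst p c : bern_mean p (fun=> c) = c.
Proof. by rewrite /bern_mean -mulr_suml bern_weight_sum mul1r. Qed.

Lemma bern_mean_sum p (I : Type) (s : seq I) (h : I -> {ffun K -> bool} -> R) :
  bern_mean p (fun z => \sum_(i <- s) h i z) = \sum_(i <- s) bern_mean p (h i).
Proof.
rewrite /bern_mean exchange_big/=.
by apply: eq_bigr => z _; rewrite mulr_sumr.
Qed.

Lemma ler_bern_mean p h g : 0 <= p <= 1 -> (forall z, h z <= g z) ->
  bern_mean p h <= bern_mean p g.
Proof. by move=> p01 hg; apply: ler_sum => z _; rewrite ler_wpM2l// bern_weight_ge0. Qed.

Lemma bern_mean_ge0 p h : 0 <= p <= 1 -> (forall z, 0 <= h z) -> 0 <= bern_mean p h.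
Proof. by move=> p01 h0; apply: sumr_ge0 => z _; rewrite mulr_ge0// bern_weight_ge0. Qed.

Lemma eq_bern_mean p h g : h =1 g -> bern_mean p h = bern_mean p g.
Proof. by move=> hg; apply: eq_bigr => z _; rewrite hg. Qed.

Lemma ler_norm_bern_mean p h : 0 <= p <= 1 ->
  `|bern_mean p h| <= bern_mean p (fun z => `|h z|).
Proof.
move=> p01; apply: (le_trans (ler_norm_sum _ _ _)).
by apply: ler_sum => z _; rewrite normrM (ger0_norm (bern_weight_ge0 _ _)).
Qed.

Lemma bern_mean_coord p k : bern_mean p (fun z => (z k)%:R) = p.
Proof.
pose u j (b : bool) : R := if j == k then b%:R else 1.
have := bern_mean_prod p u; rewrite (bigD1 k)//= /u eqxx mulr1 mulr0 addr0.
rewrite big1 => [|j /negPf->]; last by rewrite !mulr1 addrC subrK.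
rewrite mulr1 => h; rewrite -[RHS]h; apply: eq_bern_mean => z.
by rewrite (bigD1 k)//= eqxx big1 ?mulr1// => j /negPf->.
Qed.

Lemma bern_mean_cauchy_schwarz p h g : 0 <= p <= 1 ->
  bern_mean p (fun z => h z * g z) <=
  Num.sqrt (bern_mean p (fun z => h z ^+ 2)) *
  Num.sqrt (bern_mean p (fun z => g z ^+ 2)).
Proof.
move=> p01; set a := bern_mean _ _; set b := bern_mean p _; set c := bern_mean p _.
have b0 : 0 <= b by apply: bern_mean_ge0 => // z; exact: sqr_ge0.
have c0 : 0 <= c by apply: bern_mean_ge0 => // z; exact: sqr_ge0.
have key t : 0 <= b + 2 * t * a + t ^+ 2 * c.
  rewrite (_ : _ + _ = bern_mean p (fun z => (h z + t * g z) ^+ 2)).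
    by apply: bern_mean_ge0 => // z; exact: sqr_ge0.
  rewrite /a /b /c -!bern_meanZ -!bern_meanD; by apply: eq_bern_mean => z; ring.
rewrite -sqrtrM//; apply: (le_trans (ler_norm a)).
rewrite -sqrtr_sqr ler_sqrt ?mulr_ge0//.
have [c_eq0|c_neq0] := eqVneq c 0.
  have [->|a_neq0] := eqVneq a 0; first by rewrite expr0n mulr_ge0.
  have := key (- (b + 1) / (2 * a)); rewrite c_eq0 mulr0 addr0.
  rewrite (_ : 2 * _ * a = - (b + 1)); first lra.
  by field.
have := key (- a / c); have c_gt0 : 0 < c by rewrite lt_def c_neq0.
rewrite (_ : _ + _ = b - a ^+ 2 / c); last by field.
by rewrite subr_ge0 ler_pdivrMr.
Qed.

Lemma bern_mean_sqrt_le p h : 0 <= p <= 1 -> (forall z, 0 <= h z) ->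
  bern_mean p (fun z => Num.sqrt (h z)) <= Num.sqrt (bern_mean p h).
Proof.
move=> p01 h0; have := bern_mean_cauchy_schwarz (fun z => Num.sqrt (h z)) (fun=> 1) p01.
rewrite (@eq_bern_mean p _ (fun z => Num.sqrt (h z))); last by move=> z; rewrite mulr1.
rewrite [X in Num.sqrt X * _](@eq_bern_mean p _ h); last by move=> z; rewrite sqr_sqrtr.
by rewrite expr1n bern_mean_cst sqrtr1 mulr1.
Qed.

End bernoulli_mean.

(** * Maxima of Rademacher sums *)
Section rademacher.
Context (R : realType).

(** Everything follows from [1 + x <= expR x]. It gives [expR x <= (1 - x)^-1] for
[x < 1], and the two signs average to [(1 - x ^+ 2)^-1], which suffices when
[x ^+ 2 <= 2^-1]; otherwise [`|x| <= 2 * x ^+ 2]. *)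
Lemma cosh_le (x : R) : (expR x + expR (- x)) / 2 <= expR (2 * x ^+ 2).
Proof.
have bnd (y : R) : y < 1 -> expR y <= (1 - y)^-1.
  move=> y1; rewrite -[y in expR y]opprK expRN.
  by rewrite lef_pV2 ?posrE ?expR_gt0 ?subr_gt0//; have := expR_ge1Dx (- y).
have [x2|x2] := lerP (x ^+ 2) (2^-1).
  have x1 : x < 1 by nra.
  have x1' : - x < 1 by nra.
  have := expR_ge1Dx (2 * x ^+ 2); apply: le_trans.
  apply: (@le_trans _ _ (((1 - x)^-1 + (1 - - x)^-1) / 2)).
    by rewrite ler_pM2r ?invr_gt0// lerD// bnd.
  rewrite (_ : _ / 2 = (1 - x ^+ 2)^-1); last first.
    field; apply/and3P; split; apply/eqP; nra.
  rewrite -[leLHS]mul1r ler_pdivrMr; nra.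
have h (y : R) : y <= 2 * x ^+ 2 -> expR y <= expR (2 * x ^+ 2) by rewrite ler_expR.
rewrite ler_pdivrMr// mulr_natr mulr2n lerD// h//; nra.
Qed.

Definition rad_sum (K : finType) (v : K -> R) (e : {ffun K -> bool}) : R :=
  \sum_k (-1) ^+ e k * v k.

Lemma rad_mgf (K : finType) (v : K -> R) :
  bern_mean 2^-1 (fun e => expR (rad_sum v e)) <= expR (2 * \sum_k v k ^+ 2).
Proof.
under eq_bern_mean do rewrite expR_sum.
rewrite (bern_mean_prod 2^-1 (fun k (b : bool) => expR ((-1) ^+ b * v k))).
rewrite mulr_sumr expR_sum; apply: ler_prod => k _.
rewrite expr1 expr0 mul1r mulN1r; apply/andP; split.
  by rewrite addr_ge0// mulr_ge0 ?expR_ge0//; lra.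
by have := cosh_le (v k); lra.
Qed.

(** The index [j] that dominates [U] may depend on the signs: [U] stands for the
value of a process at a random, almost maximizing index. The proof is the tangent
bound
[y <= expR y / a - 1 + ln a] at [y = lam * U e], with [a] an upper bound for the sum
of all the moment generating functions. *)
Lemma subgauss_max (K J : finType) (v : J -> K -> R) (s : R)
    (U : {ffun K -> bool} -> R) : 0 <= s ->
  (forall j, \sum_k v j k ^+ 2 <= s ^+ 2) ->
  (forall e, exists j, U e <= `|rad_sum (v j) e|) ->
  bern_mean 2^-1 U <= 3 * s * Num.sqrt (ln (2 * #|J|%:R)).
Proof.
move=> s0 vs Uv.
have half01 : 0 <= (2^-1 : R) <= 1 by apply/andP; split; lra.
have J0 : (0 < #|J|)%N.
  by have [j _] := Uv [ffun=> false]; apply/card_gt0P; exists j.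
have [s_eq0|s_neq0] := eqVneq s 0.
  rewrite s_eq0 mulr0 mul0r -(bern_mean_cst K 2^-1 0).
  apply: ler_bern_mean => // e; have [j /le_trans->//] := Uv e.
  rewrite normr_le0 /rad_sum big1// => k _.
  suff -> : v j k = 0 by rewrite mulr0.
  have /eqP : \sum_k v j k ^+ 2 = 0.
    apply/eqP; rewrite eq_le sumr_ge0 ?andbT; last by move=> *; exact: sqr_ge0.
    by rewrite (le_trans (vs j))// s_eq0 expr0n.
  rewrite psumr_eq0; last by move=> *; exact: sqr_ge0.
  by move=> /allP /(_ k); rewrite mem_index_enum sqrf_eq0 => /(_ isT)/eqP.
have {s_neq0}s_gt0 : 0 < s by rewrite lt_def s_neq0.
set n : R := #|J|%:R; have n1 : 1 <= n by rewrite ler1n.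
have l0 : 0 < ln (2 * n) by rewrite ln_gt0//; lra.
(* [lam = l / s] balances [ln (2 * n) / lam] against [2 * lam * s ^+ 2]. *)
set l := Num.sqrt (ln (2 * n)).
have ll : l ^+ 2 = ln (2 * n) by rewrite sqr_sqrtr// ltW.
have l_gt0 : 0 < l by rewrite sqrtr_gt0.
set lam := l / s; have lam_gt0 : 0 < lam by rewrite divr_gt0.
set a := 2 * n * expR (2 * l ^+ 2).
have a_gt0 : 0 < a by rewrite mulr_gt0 ?expR_gt0//; lra.
have lnaE : ln a = 3 * l ^+ 2.
  by rewrite lnM ?posrE ?expR_gt0//; [rewrite expRK -ll; ring|lra].
suff : lam * bern_mean 2^-1 U <= 3 * l ^+ 2.
  rewrite /lam -(ler_pM2l s_gt0) => h.
  rewrite -(ler_pM2l l_gt0); apply: le_trans (le_trans _ h) _.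
    by rewrite mulrA (_ : s * (l / s) = l)//; field; lra.
  by rewrite le_eqVlt; apply/orP; left; apply/eqP; ring.
rewrite -bern_meanZ.
pose g e := \sum_j (expR (rad_sum (fun k => lam * v j k) e) +
                    expR (rad_sum (fun k => - (lam * v j k)) e)).
apply: (@le_trans _ _ (bern_mean 2^-1 (fun e => (ln a - 1) + a^-1 * g e))).
  apply: ler_bern_mean => // e.
  have : expR (lam * U e) <= g e.
    have [j Uj] := Uv e; rewrite /g (bigD1 j)//=.
    apply: (@le_trans _ _ (expR (lam * `|rad_sum (v j) e|))).
      by rewrite ler_expR ler_pM2l.
    have eN w : rad_sum (fun k => - (lam * w k)) e = - (lam * rad_sum w e).
      by rewrite /rad_sum mulr_sumr -sumrN; apply: eq_bigr => k _; ring.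
    have eP w : rad_sum (fun k => lam * w k) e = lam * rad_sum w e.
      by rewrite /rad_sum mulr_sumr; apply: eq_bigr => k _; ring.
    rewrite eN eP; set y := rad_sum _ _.
    apply: (@le_trans _ _ (expR (lam * y) + expR (- (lam * y)))).
      by case: (ger0P y) => _; rewrite ?mulrN ?lerDl ?lerDr; exact: expR_ge0.
    by rewrite lerDl; apply: sumr_ge0 => i _; apply: addr_ge0; exact: expR_ge0.
  move=> h; have := expR_ge1Dx (lam * U e - ln a).
  rewrite expRD expRN lnK ?posrE// [_ * a^-1]mulrC => h1.
  have : a^-1 * expR (lam * U e) <= a^-1 * g e by rewrite ler_pM2l// invr_gt0.
  by lra.
rewrite bern_meanD bern_mean_cst bern_meanZ bern_mean_sum.
have : \sum_(j : J) bern_mean 2^-1 (fun e => expR (rad_sum (fun k => lam * v j k) e) +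
                    expR (rad_sum (fun k => - (lam * v j k)) e)) <= a.
  apply: (@le_trans _ _ (\sum_(j : J) (2 * expR (2 * l ^+ 2)))).
    apply: ler_sum => j _; rewrite bern_meanD.
    have hh : expR (2 * \sum_k (lam * v j k) ^+ 2) <= expR (2 * l ^+ 2).
      rewrite ler_expR ler_pM2l//.
      rewrite (_ : \sum_k _ = lam ^+ 2 * \sum_k v j k ^+ 2); last first.
        by rewrite mulr_sumr; apply: eq_bigr => k _; rewrite exprMn.
      apply: (@le_trans _ _ (lam ^+ 2 * s ^+ 2)); first by rewrite ler_wpM2l ?sqr_ge0.
      by rewrite -exprMn /lam divfK// gt_eqF.
    rewrite mulr_natl mulr2n lerD//; apply: le_trans (rad_mgf _) _ => //.
    by under eq_bigr do rewrite sqrrN.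
  rewrite /a mulrAC /n -sum1_card natr_sum mulr_sumr.
  by apply: ler_sum => j _; rewrite mulr1.
set q := \sum_(j : J) _ => qa.
have : a^-1 * q <= 1 by rewrite ler_pdivrMl// mulr1.
by rewrite lnaE; lra.
Qed.

End rademacher.

(** * Dyadic chaining *)
Section chaining.
Context (R : realType).

Lemma sqrt_le_of_sqr (x y : R) : 0 <= y -> x <= y ^+ 2 -> Num.sqrt x <= y.
Proof.
by move=> y0 xy; rewrite -[leRHS]ger0_norm// -sqrtr_sqr ler_wsqrtr.
Qed.

(** Separates the number [a] of pairs (sign, group) from the covering numbers: as
[ln a >= ln 2 >= 2^-1], the sum [ln a + ln b] is at most
[ln a * (1 + 4 * (phi ^+ 2 - 1))]. *)
Lemma sqrt_ln_le (a b phi : R) : 2 <= a -> 1 <= b ->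
  1 <= phi -> ln b <= 2 * (phi ^+ 2 - 1) ->
  Num.sqrt (ln (a * b)) <= 2 * Num.sqrt (ln a) * phi.
Proof.
move=> a2 b1 phi1 bphi.
have ln2 : 2^-1 <= ln (2 : R).
  have := @le_ln1Dx R (- 2^-1); rewrite (_ : 1 + - 2^-1 = 2^-1 :> R); last by field.
  by rewrite lnV ?posrE//; lra.
have lna : 2^-1 <= ln a.
  by rewrite (le_trans ln2)// ler_ln ?posrE//; lra.
apply: sqrt_le_of_sqr; first by rewrite !mulr_ge0 ?sqrtr_ge0//; lra.
rewrite !exprMn sqr_sqrtr; last by lra.
rewrite lnM ?posrE; [|lra|lra].
have h : 0 <= phi ^+ 2 - 1 by nra.
have : 0 <= (ln a - 2^-1) * (phi ^+ 2 - 1) by rewrite mulr_ge0//; lra.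
by nra.
Qed.

Lemma rad_sumB (K : finType) (v w : K -> R) e :
  rad_sum (fun k => v k - w k) e = rad_sum v e - rad_sum w e.
Proof. by rewrite /rad_sum -sumrB; apply: eq_bigr => k _; rewrite mulrBr. Qed.

Lemma ler_norm_rad_sum (K : finType) (v : K -> R) e :
  `|rad_sum v e| <= \sum_k `|v k|.
Proof.
apply: (le_trans (ler_norm_sum _ _ _)); apply: ler_sum => k _.
by rewrite normrM normrX normrN1 expr1n mul1r.
Qed.

Variables (K : finType) (T : Type) (G : set T) (M : nat).
Variables (v : 'I_M -> T -> K -> R) (D2 : T -> T -> R) (L eta : R).
Variables (n : nat -> nat) (c : forall j, 'I_(n j) -> T) (phi : nat -> R).
Arguments c : clear implicits.
Hypothesis M0 : (0 < M)%N.
Hypothesis L0 : 0 <= L.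
Hypothesis eta0 : 0 <= eta.
Hypothesis D2tri : forall f g h, D2 g h <= 2 * (D2 f g + D2 f h).
Hypothesis v_lip : forall m f g, G f -> G g ->
  \sum_k (v m f k - v m g k) ^+ 2 <= L ^+ 2 * D2 f g.
Hypothesis v_bnd : forall m f, G f -> \sum_k v m f k ^+ 2 <= (L * eta) ^+ 2.
Hypothesis cG : forall j i, G (c j i).
Hypothesis c_cover : forall j f, G f -> exists i, D2 f (c j i) <= (2^-1 ^+ j * eta) ^+ 2.
Hypothesis c_card : forall j, Num.sqrt (1 + ln (n j)%:R) <= phi j.
Hypothesis phi_mono : forall j, phi j <= phi j.+1.

Let lam : R := Num.sqrt (ln (2 * M%:R)).

(** Level [j] is a cover of radius [2^-1 ^+ j * eta], for the distance whose square
is [D2]; a squared distance obeys the triangle inequality up to the factor [2].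
The chain starts at level [1], whose centers are at most [n 1] functions of norm at
most [L * eta], and each later link is a maximum over pairs of centers of two
consecutive levels. The last summand is the distance from level [J.+1] to the
function itself. *)
Lemma chaining_bound (J : nat) (U : {ffun K -> bool} -> R) :
  (forall e, exists m f, G f /\ U e <= `|rad_sum (v m f) e|) ->
  bern_mean 2^-1 U <=
    24 * L * eta * lam * (\sum_(j < J.+1) 2^-1 ^+ j.+1 * phi j.+1)
    + #|K|%:R * (L * (2^-1 ^+ J.+1 * eta)).
Proof.
move=> Usup.
have half01 : 0 <= (2^-1 : R) <= 1 by apply/andP; split; lra.
have M1 : 1 <= M%:R :> R by rewrite ler1n.
have n_gt0 j : (0 < n j)%N.
  have [m [f [Gf _]]] := Usup [ffun=> false].
  by have [i _] := c_cover j Gf; case: (n j) i => // -[].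
have nR1 j : 1 <= (n j)%:R :> R by rewrite ler1n.
have phi1 j : 1 <= phi j.
  apply: le_trans (c_card j); rewrite -[leLHS]sqrtr1 ler_wsqrtr//.
  by rewrite lerDl ln_ge0.
have lnn j : ln (n j)%:R <= phi j ^+ 2 - 1.
  have l0 : 0 <= ln ((n j)%:R : R) by rewrite ln_ge0.
  rewrite lerBrDl -[leLHS]sqr_sqrtr ?addr_ge0//.
  by rewrite lerXn2r ?nnegrE ?sqrtr_ge0// (le_trans ler01).
have lam0 : 0 <= lam by exact: sqrtr_ge0.
have [/= mm /choice[ff Uff]] := choice Usup.
have Gff e : G (ff e) by have [] := Uff e.
have pi_ex j : exists pi : {ffun K -> bool} -> 'I_(n j),
    forall e, D2 (ff e) (c j (pi e)) <= (2^-1 ^+ j * eta) ^+ 2.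
  by have [pi ?] := choice (fun e => c_cover j (Gff e)); exists pi.
have [pi pi_cover] : exists pi : forall j, {ffun K -> bool} -> 'I_(n j),
    forall j e, D2 (ff e) (c j (pi j e)) <= (2^-1 ^+ j * eta) ^+ 2.
  exists (fun j => projT1 (cid (pi_ex j))) => j e.
  by have := projT2 (cid (pi_ex j)) e.
pose p j e := c j (pi j e).
pose Y f e := rad_sum (v (mm e) f) e.
(* telescoping along the centers [p 1], ..., [p J.+1] closest to [ff e] *)
have decomp e : U e <= `|Y (p 1%N e) e|
    + \sum_(j < J) `|Y (p j.+2 e) e - Y (p j.+1 e) e| + `|Y (ff e) e - Y (p J.+1 e) e|.
  have [_ /le_trans] := Uff e; apply.
  elim: J => [|J' IH].
    rewrite big_ord0 addr0 -/(Y (ff e) e) -[X in `|X| <= _](subrK (Y (p 1%N e) e)).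
    by apply: (le_trans (ler_normD _ _)); rewrite addrC.
  apply: (le_trans IH); rewrite big_ord_recr/= -!addrA lerD2l lerD2l.
  apply: le_trans (ler_normD _ _); rewrite le_eqVlt; apply/orP; left; apply/eqP.
  by congr (`|_|); ring.
apply: (le_trans (ler_bern_mean half01 decomp)).
rewrite !bern_meanD bern_mean_sum; apply: lerD; last first.
  rewrite -(bern_mean_cst K 2^-1 (#|K|%:R * _)); apply: ler_bern_mean => // e.
  rewrite /Y -rad_sumB; apply: (le_trans (ler_norm_rad_sum _ _)).
  rewrite -sum1_card natr_sum mulr_suml; apply: ler_sum => k _; rewrite mul1r.
  have q0 : 0 <= L * (2^-1 ^+ J.+1 * eta) by rewrite !mulr_ge0// exprn_ge0; lra.
  rewrite -(ler_pXn2r (n := 2))// ?nnegrE//; rewrite real_normK ?num_real// exprMn.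
  apply: le_trans (ler_wpM2l _ (pi_cover J.+1 e)); last exact: sqr_ge0.
  apply: le_trans (v_lip (mm e) _ _) => //; rewrite (bigD1 k)//= lerDl.
  by apply: sumr_ge0 => i _; exact: sqr_ge0.
rewrite mulr_sumr big_ord_recl; apply: lerD.
  apply: (@le_trans _ _ (3 * (L * eta) * Num.sqrt (ln (2 * #|{: 'I_M * 'I_(n 1%N)}|%:R)))).
    apply: (@subgauss_max _ _ _ (fun q : 'I_M * 'I_(n 1%N) => v q.1 (c 1 q.2))).
    - by rewrite mulr_ge0.
    - by move=> q; exact: v_bnd.
    - by move=> e; exists (mm e, pi 1%N e).
  have := @sqrt_ln_le (2 * M%:R) (n 1%N)%:R (phi 1%N) _ (nR1 1%N) (phi1 1%N) _.
  rewrite card_prod !card_ord natrM [2 * (_ * _)]mulrA -/lam => h.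
  apply: (@le_trans _ _ (3 * (L * eta) * (2 * lam * phi 1%N))).
    rewrite ler_wpM2l ?mulr_ge0//; apply: h; first lra.
    have := lnn 1%N; have := nR1 1%N; have := @ln_ge0 R (n 1%N)%:R; lra.
  rewrite [leRHS](_ : _ = 12 * (L * eta * lam * phi 1%N)); last by rewrite /= expr1; field.
  rewrite [leLHS](_ : _ = 6 * (L * eta * lam * phi 1%N)); last by ring.
  rewrite ler_wpM2r ?mulr_ge0//; last lra.
  by rewrite (le_trans ler01).
apply: ler_sum => j _; rewrite lift0.
set s := 2 * (2^-1 ^+ j.+1 * (L * eta)).
have hj : 0 <= (2^-1 : R) ^+ j.+1 by rewrite exprn_ge0//; lra.
pose JT : finType := ('I_M * 'I_(n j.+1) * 'I_(n j.+2))%type.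
apply: (@le_trans _ _ (3 * s * Num.sqrt (ln (2 * #|JT|%:R)))).
  (* Pairs of centers that are too far apart to be linked are given the zero vector,
     so that the norm bound holds for every pair. *)
  pose cl (q : JT) := D2 (c j.+1 q.1.2) (c j.+2 q.2) <= (2 * (2^-1 ^+ j.+1 * eta)) ^+ 2.
  apply: (@subgauss_max _ _ _ (fun (q : JT) k => if cl q then
     v q.1.1 (c j.+2 q.2) k - v q.1.1 (c j.+1 q.1.2) k else 0)).
  - by rewrite !mulr_ge0.
  - move=> q; have [clq|_] := boolP (cl q); last first.
      by rewrite big1 ?sqr_ge0// => *; rewrite expr0n.
    under eq_bigr do rewrite -sqrrN opprB.
    apply: (le_trans (v_lip _ _ _)) => //.
    rewrite (_ : s = L * (2 * (2^-1 ^+ j.+1 * eta))); last by rewrite /s; ring.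
    by rewrite exprMn ler_wpM2l// sqr_ge0.
  - move=> e; exists (mm e, pi j.+1 e, pi j.+2 e).
    suff -> : cl (mm e, pi j.+1 e, pi j.+2 e) by rewrite rad_sumB.
    rewrite /cl/=; apply: (le_trans (D2tri (ff e) _ _)).
    have := pi_cover j.+1 e; have := pi_cover j.+2 e.
    rewrite [_ ^+ j.+2]exprS -mulrA ![(_ * _) ^+ 2]exprMn.
    have := sqr_ge0 ((2^-1 : R) ^+ j.+1); have := sqr_ge0 eta.
    set aa := _ ^+ 2; set bb := _ ^+ 2 => aa0 bb0.
    have := mulr_ge0 bb0 aa0; lra.
have := @sqrt_ln_le (2 * M%:R) ((n j.+1)%:R * (n j.+2)%:R) (phi j.+2) _ _ (phi1 j.+2) _.
rewrite !card_prod !card_ord !natrM -[M%:R * _ * _]mulrA [2 * (M%:R * _)]mulrA -/lam => h.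
apply: (@le_trans _ _ (3 * s * (2 * lam * phi j.+2))).
  rewrite ler_wpM2l ?mulr_ge0//; apply: h; first lra.
    by rewrite -[leLHS]mulr1 ler_pM.
  rewrite lnM ?posrE ?ltr0n//.
  have := lnn j.+1; have := lnn j.+2.
  have : phi j.+1 ^+ 2 <= phi j.+2 ^+ 2.
    by rewrite lerXn2r ?nnegrE// (le_trans ler01).
  lra.
rewrite [leRHS](_ : _ = 12 * (2^-1 ^+ j.+1 * (L * eta) * lam * phi j.+2)); last first.
  by rewrite [_ ^+ j.+2]exprS; field.
by rewrite /s le_eqVlt; apply/orP; left; apply/eqP; ring.
Qed.

End chaining.

(** * Suprema of linear processes *)
Section sup_abs.
Context (R : realType).

Definition sup_abs (Q : Type) (G : set Q) (h : Q -> R) : R := sup [set `|h q| | q in G].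

Lemma sup_abs_ub (Q : Type) (G : set Q) (h : Q -> R) (b : R) q :
  (forall q, G q -> `|h q| <= b) -> G q -> `|h q| <= sup_abs G h.
Proof.
move=> hb Gq; apply: ub_le_sup; last by exists q.
by exists b => _ [q' Gq' <-]; exact: hb.
Qed.

Lemma sup_abs_le (Q : Type) (G : set Q) (h : Q -> R) (b : R) :
  G !=set0 -> (forall q, G q -> `|h q| <= b) -> sup_abs G h <= b.
Proof.
move=> [q Gq] hb; apply: ge_sup; first by exists `|h q|, q.
by move=> _ [q' Gq' <-]; exact: hb.
Qed.

Lemma sup_abs_ge0 (Q : Type) (G : set Q) (h : Q -> R) (b : R) :
  G !=set0 -> (forall q, G q -> `|h q| <= b) -> 0 <= sup_abs G h.
Proof. by move=> [q Gq] hb; apply: le_trans (sup_abs_ub hb Gq). Qed.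

Lemma sup_abs_adherent (Q : Type) (G : set Q) (h : Q -> R) (b tau : R) :
  G !=set0 -> (forall q, G q -> `|h q| <= b) -> 0 < tau ->
  exists q, G q /\ sup_abs G h - tau <= `|h q|.
Proof.
move=> [q Gq] hb tau0.
have [] := @sup_adherent R [set `|h q| | q in G] tau tau0.
  split; first by exists `|h q|, q.
  by exists b => _ [q' Gq' <-]; exact: hb.
by move=> _ [q' Gq' <-] /ltW; exists q'.
Qed.

Lemma exp2_small (c tau : R) : 0 < tau -> exists J : nat, c * 2^-1 ^+ J <= tau.
Proof.
move=> tau0; exists (Num.bound (`|c| / tau)); set J := Num.bound _.
have := @archi_boundP R (`|c| / tau); rewrite divr_ge0 ?(ltW tau0)// => /(_ isT).
rewrite -/J ltr_pdivrMr// => cJ.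
rewrite exprVn ler_pdivrMr ?exprn_gt0//; apply: (le_trans (ler_norm c)).
apply: (le_trans (ltW cJ)); rewrite mulrC ler_pM2l//.
by rewrite -natrX ler_nat ltnW// ltn_expl.
Qed.

End sup_abs.

Section chaining_sup.
Context (R : realType) (K : finType) (T : Type) (G : set T) (M : nat).
Variables (v : 'I_M -> T -> K -> R) (D2 : T -> T -> R) (L eta B bnd : R).
Variables (n : nat -> nat) (c : forall j, 'I_(n j) -> T) (phi : nat -> R).
Arguments c : clear implicits.
Hypothesis M0 : (0 < M)%N.
Hypothesis G0 : G !=set0.
Hypothesis L0 : 0 <= L.
Hypothesis eta0 : 0 <= eta.
Hypothesis D2tri : forall f g h, D2 g h <= 2 * (D2 f g + D2 f h).
Hypothesis v_lip : forall m f g, G f -> G g ->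
  \sum_k (v m f k - v m g k) ^+ 2 <= L ^+ 2 * D2 f g.
Hypothesis v_bnd : forall m f, G f -> \sum_k v m f k ^+ 2 <= (L * eta) ^+ 2.
Hypothesis cG : forall j i, G (c j i).
Hypothesis c_cover : forall j f, G f -> exists i, D2 f (c j i) <= (2^-1 ^+ j * eta) ^+ 2.
Hypothesis c_card : forall j, Num.sqrt (1 + ln (n j)%:R) <= phi j.
Hypothesis phi_mono : forall j, phi j <= phi j.+1.
Hypothesis phi_sum : forall J, \sum_(j < J) 2^-1 ^+ j.+1 * phi j.+1 <= B.

(** A near-maximizer is selected for each vector of signs; the number of levels then
tends to infinity and the remainder of the chain vanishes. *)
Lemma chaining_sup :
  bern_mean 2^-1 (fun e => sup_abs [set q : 'I_M * T | G q.2]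
     (fun q => rad_sum (v q.1 q.2) e)) <=
  24 * L * eta * Num.sqrt (ln (2 * M%:R)) * B.
Proof.
have half01 : 0 <= (2^-1 : R) <= 1 by apply/andP; split; lra.
have vk m f k : G f -> `|v m f k| <= L * eta.
  move=> Gf; rewrite -(ler_pXn2r (n := 2))// ?nnegrE// ?mulr_ge0//.
  rewrite real_normK ?num_real//; apply: le_trans (v_bnd m Gf).
  by rewrite (bigD1 k)//= lerDl; apply: sumr_ge0 => i _; exact: sqr_ge0.
have bounded e (q : 'I_M * T) : G q.2 -> `|rad_sum (v q.1 q.2) e| <= \sum_(k : K) (L * eta).
  by move=> Gq; apply: (le_trans (ler_norm_rad_sum _ _)); apply: ler_sum => k _; exact: vk.
apply/ler_addgt0Pr => tau tau0.
have [J J_small] := exp2_small (#|K|%:R * (L * eta)) (divr_gt0 tau0 (@ltr0n R 2)).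
pose Phi e := sup_abs [set q : 'I_M * T | G q.2] (fun q => rad_sum (v q.1 q.2) e).
have tau2 : 0 < tau / 2 by rewrite divr_gt0.
have near e : exists m f, G f /\ Phi e - tau / 2 <= `|rad_sum (v m f) e|.
  have G'0 : [set q : 'I_M * T | G q.2] !=set0.
    by have [f Gf] := G0; exists (Ordinal M0, f).
  by have [[m f] [Gf Uf]] := sup_abs_adherent G'0 (bounded e) tau2; exists m, f.
have := chaining_bound M0 L0 eta0 D2tri v_lip v_bnd cG c_cover c_card phi_mono J near.
rewrite bern_meanD bern_mean_cst.
set A := bern_mean _ _; set S := \sum_(j < _) _ => h.
have SB : 24 * L * eta * Num.sqrt (ln (2 * M%:R)) * S <=
    24 * L * eta * Num.sqrt (ln (2 * M%:R)) * B.
  by rewrite ler_wpM2l ?mulr_ge0 ?sqrtr_ge0//; exact: phi_sum.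
have : #|K|%:R * (L * (2^-1 ^+ J.+1 * eta)) <= tau / 2.
  apply: le_trans J_small; rewrite exprS.
  have : 0 <= #|K|%:R * (L * eta) * 2^-1 ^+ J by rewrite !mulr_ge0// exprn_ge0; lra.
  lra.
lra.
Qed.

End chaining_sup.

Section symmetrization.
Context (R : realType) (K : finType) (Q : Type) (G : set Q) (a : Q -> K -> R) (b : K -> R).
Hypothesis G0 : G !=set0.
Hypothesis ab : forall q k, G q -> `|a q k| <= b k.

Let Phi (v : K -> R) : R := sup_abs G (fun q => \sum_k v k * a q k).

Let Phi_bnd (v : K -> R) q : G q -> `|\sum_k v k * a q k| <= \sum_k `|v k| * b k.
Proof.
move=> Gq; apply: (le_trans (ler_norm_sum _ _ _)); apply: ler_sum => k _.
by rewrite normrM ler_wpM2l// ab.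
Qed.

Let PhiB (v w : K -> R) : Phi (fun k => v k - w k) <= Phi v + Phi w.
Proof.
apply: sup_abs_le => // q Gq.
rewrite (_ : \sum_k _ = (\sum_k v k * a q k) - \sum_k w k * a q k); last first.
  by rewrite -sumrB; apply: eq_bigr => k _; rewrite mulrBl.
apply: (le_trans (ler_normB _ _)); apply: lerD.
  exact: (sup_abs_ub (@Phi_bnd v)).
exact: (sup_abs_ub (@Phi_bnd w)).
Qed.

Let swap (e : {ffun K -> bool}) (zz : {ffun K -> bool} * {ffun K -> bool}) :=
  ([ffun k => if e k then zz.2 k else zz.1 k], [ffun k => if e k then zz.1 k else zz.2 k]).

Let swapK e : involutive (swap e).
Proof.
move=> [z z']; congr pair; apply/ffunP => k; rewrite !ffunE/=;
  by case: ifP => ek; rewrite ?ffunE ek.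
Qed.

Let swap_weight (p : R) e zz : bern_weight p (swap e zz).1 * bern_weight p (swap e zz).2 =
  bern_weight p zz.1 * bern_weight p zz.2.
Proof.
rewrite /bern_weight -!big_split/=; apply: eq_bigr => k _; rewrite !ffunE.
by case: (e k) => //; rewrite mulrC.
Qed.

Let swap_mean (p : R) e (h : {ffun K -> bool} -> {ffun K -> bool} -> R) :
  bern_mean p (fun z => bern_mean p (h z)) =
  bern_mean p (fun z => bern_mean p (fun z' => h (swap e (z, z')).1 (swap e (z, z')).2)).
Proof.
have pairE g : bern_mean p (fun z => bern_mean p (g z)) =
    \sum_zz bern_weight p zz.1 * bern_weight p zz.2 * g zz.1 zz.2.
  rewrite -(pair_bigA _ (fun z z' => bern_weight p z * bern_weight p z' * g z z'))/=.
  by apply: eq_bigr => z _; rewrite mulr_sumr; apply: eq_bigr => z' _; rewrite mulrA.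
rewrite !pairE (reindex_inj (inv_inj (swapK e))).
by apply: eq_bigr => -[z z'] _; rewrite swap_weight.
Qed.

(** Centering is a mean over an independent copy of the selectors. Exchanging the
coordinates of the two copies wherever the sign is negative preserves the product
weight and multiplies each difference by the sign, for every choice of signs; the
triangle inequality separates the copies. *)
Lemma symmetrization (p : R) : 0 <= p <= 1 ->
  bern_mean p (fun z => Phi (fun k => (z k)%:R - p)) <=
  2 * bern_mean p (fun z => bern_mean 2^-1 (fun e => Phi (fun k => (-1) ^+ e k * (z k)%:R))).
Proof.
move=> p01; have half01 : 0 <= (2^-1 : R) <= 1 by apply/andP; split; lra.
pose D (z z' : {ffun K -> bool}) := Phi (fun k => (z k)%:R - (z' k)%:R).
have step1 : bern_mean p (fun z => Phi (fun k => (z k)%:R - p)) <=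
    bern_mean p (fun z => bern_mean p (D z)).
  apply: ler_bern_mean => // z; apply: sup_abs_le => // q Gq.
  rewrite (_ : \sum_k _ =
      bern_mean p (fun z' => \sum_k ((z k)%:R - (z' k)%:R) * a q k)); last first.
    rewrite bern_mean_sum; apply: eq_bigr => k _.
    rewrite (@eq_bern_mean _ _ _ _
      (fun z' => (z k)%:R * a q k + (- a q k) * (z' k)%:R)); last first.
      by move=> z'; ring.
    by rewrite bern_meanD bern_mean_cst bern_meanZ bern_mean_coord; ring.
  apply: (le_trans (ler_norm_bern_mean _ p01)); apply: ler_bern_mean => // z'.
  exact: (sup_abs_ub (@Phi_bnd (fun k => (z k)%:R - (z' k)%:R))).
have step2 (e : {ffun K -> bool}) : bern_mean p (fun z => bern_mean p (D z)) <=
    2 * bern_mean p (fun z => Phi (fun k => (-1) ^+ e k * (z k)%:R)).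
  (* The bound holds for each fixed [e]; the signs are averaged afterwards. *)
  rewrite (swap_mean p e) mulr_natl mulr2n.
  pose P (z : {ffun K -> bool}) := Phi (fun k => (-1) ^+ e k * (z k)%:R); rewrite -/P.
  have -> : bern_mean p P + bern_mean p P =
      bern_mean p (fun z => bern_mean p (fun z' => P z + P z')).
    transitivity (bern_mean p (fun z => P z + bern_mean p P)).
      by rewrite bern_meanD bern_mean_cst.
    by apply: eq_bern_mean => z; rewrite bern_meanD bern_mean_cst.
  apply: ler_bern_mean => // z; apply: ler_bern_mean => // z'.
  apply: le_trans (PhiB _ _); rewrite le_eqVlt; apply/orP; left; apply/eqP.
  congr (sup_abs _ _); apply/funext => q; apply: eq_bigr => k _; rewrite !ffunE.
  by case: (e k); rewrite ?expr1 ?expr0; ring.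
apply: (le_trans step1); rewrite -(bern_mean_cst K 2^-1 (bern_mean p _)).
apply: (le_trans (ler_bern_mean half01 step2)); rewrite bern_meanZ.
rewrite ler_pM2l// le_eqVlt; apply/orP; left; apply/eqP.
rewrite {1}/bern_mean; under eq_bigr => e _ do rewrite mulr_sumr.
rewrite exchange_big; apply: eq_bigr => z _; rewrite mulr_sumr.
by apply: eq_bigr => e _; rewrite mulrCA.
Qed.

End symmetrization.

(** * The maximal inequality for fixed data *)
Section conditional.
Context (R : realType) (I : finType) (M N : nat) (T : Type) (G : set T).
Variables (ev : T -> I -> R) (Fv : I -> R) (phi : R -> R) (J delta Delta : R).
Hypothesis M0 : (0 < M)%N.
Hypothesis N0 : (0 < N)%N.
Hypothesis NI : (N <= #|I|)%N.
Hypothesis G0 : G !=set0.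
Hypothesis evF : forall t i, G t -> `|ev t i| <= Fv i.
Hypothesis J0 : 0 <= J.
Hypothesis delta0 : 0 < delta.
Hypothesis Delta_ub : forall t, G t -> #|I|%:R^-1 * \sum_i ev t i ^+ 2 <= Delta.

Notation K := (I * 'I_M)%type.
Notation obs := {ffun K -> bool}.

(** The vector over the pairs (observation, group) that is [b t] in group [m] and zero
in the others. The maximum over the groups thus becomes a supremum over pairs
[(m, t)] of one linear process. *)
Definition column (b : T -> I -> R) (q : 'I_M * T) (k : K) : R :=
  (k.2 == q.1)%:R * b q.2 k.1.
Local Notation G' := [set q : 'I_M * T | G q.2].

Lemma sum_column (u : K -> R) (b : T -> I -> R) m t :
  \sum_k u k * column b (m, t) k = \sum_i u (i, m) * b t i.
Proof.
transitivity (\sum_(k : K) u (k.1, k.2) * column b (m, t) (k.1, k.2)).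
  by apply: eq_bigr => -[].
rewrite -(pair_bigA _ (fun i m' => u (i, m') * column b (m, t) (i, m')))/=.
apply: eq_bigr => i _; rewrite (bigD1 m)//= big1 ?addr0; last first.
  by move=> m' /negPf m'm; rewrite /column/= m'm mul0r mulr0.
by rewrite /column/= eqxx mul1r.
Qed.

(** Distances and the envelope are measured over the selections of all the groups
together: a single probability, and a single cover, serves every group. *)
Definition dist2 (z : obs) (f g : T) : R :=
  \sum_k (z k)%:R * (ev f k.1 - ev g k.1) ^+ 2.
Definition env2 (z : obs) : R := \sum_k (z k)%:R * Fv k.1 ^+ 2.
Definition envmax (z : obs) : R := \big[Num.max/0]_i \big[Num.max/0]_m ((z (i, m))%:R * Fv i).
(** The largest squared norm within one group, as opposed to the pooled [env2]. *)
Definition rad2 (z : obs) : R := sup_abs G' (fun q => \sum_k (z k)%:R * column ev q k ^+ 2).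

Hypothesis phi_mono : forall x y, 0 < x -> x <= y -> phi y <= phi x.
Hypothesis phi_sum : forall t m, 0 < t ->
  \sum_(j < m) 2^-1 ^+ j.+1 * t * phi (2^-1 ^+ j.+1 * t) <= 2 * J * (1 + t / delta).
Hypothesis phi_cover : forall z : obs, 0 < env2 z -> forall eps, 0 < eps ->
  exists n (c : 'I_n -> T), [/\ forall i, G (c i),
    forall t, G t -> exists i, dist2 z t (c i) <= eps ^+ 2 * env2 z
    & Num.sqrt (1 + ln n%:R) <= phi eps].

Local Notation lam := (Num.sqrt (ln (2 * M%:R)) : R).
Local Notation p := (N%:R / #|I|%:R : R).

Let F0 i : 0 <= Fv i.
Proof. by have [t Gt] := G0; apply: le_trans (evF i Gt). Qed.

Let G'0 : G' !=set0.
Proof. by have [t Gt] := G0; exists (Ordinal M0, t). Qed.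

Let p01 : 0 <= p <= 1.
Proof.
have I0 : 0 < #|I|%:R :> R by rewrite ltr0n (leq_trans N0).
by rewrite divr_ge0//= ler_pdivrMr// mul1r ler_nat.
Qed.

Let sq_le (x y : R) : 0 <= y -> `|x| <= y -> x ^+ 2 <= y ^+ 2.
Proof. by move=> y0 xy; rewrite -[x ^+ 2]real_normK ?num_real// ler_pXn2r ?nnegrE. Qed.

Let column_bnd (q : 'I_M * T) k : G' q -> `|column ev q k| <= Fv k.1.
Proof.
move=> Gq; rewrite /column; case: eqP => _; last by rewrite mul0r normr0.
by rewrite mul1r; exact: evF.
Qed.

Let rad2_bnd (z : obs) (q : 'I_M * T) : G' q ->
  `|\sum_k (z k)%:R * column ev q k ^+ 2| <= env2 z.
Proof.
move=> Gq; rewrite ger0_norm; last by apply: sumr_ge0 => k _; rewrite mulr_ge0 ?sqr_ge0.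
by apply: ler_sum => k _; rewrite ler_wpM2l// sq_le// column_bnd.
Qed.

Let rad2_ge0 z : 0 <= rad2 z.
Proof. exact: sup_abs_ge0 (@rad2_bnd z). Qed.

Let rad2_env z : rad2 z <= env2 z.
Proof. exact: sup_abs_le (@rad2_bnd z). Qed.

Let rad2_ub (z : obs) q : G' q -> \sum_k (z k)%:R * column ev q k ^+ 2 <= rad2 z.
Proof. by move=> Gq; apply: le_trans (sup_abs_ub (@rad2_bnd z) Gq); exact: ler_norm. Qed.

(** Chaining at the scale [S], the square root of [rad2 z], with covers at the
relative radii [2^-1 ^+ j * t], where [t] is the ratio of [S] to the norm of the
envelope; [phi_sum] then makes the bound affine in [S]. The map [b] is [ev]
itself, or its square with [L = 2 * envmax z]. *)
Lemma rademacher_bound (z : obs) (b : T -> I -> R) (L : R) : 0 <= L ->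
  (forall f g k, G f -> G g -> z k ->
    (b f k.1 - b g k.1) ^+ 2 <= L ^+ 2 * (ev f k.1 - ev g k.1) ^+ 2) ->
  (forall f k, G f -> z k -> b f k.1 ^+ 2 <= L ^+ 2 * ev f k.1 ^+ 2) ->
  bern_mean 2^-1 (fun e => sup_abs G' (fun q =>
    \sum_k ((-1) ^+ e k * (z k)%:R) * column b q k)) <=
  48 * L * lam * J * (Num.sqrt (env2 z) + Num.sqrt (rad2 z) / delta).
Proof.
move=> L0 b_lip b_bnd.
pose v m f (k : K) : R := (z k)%:R * column b (m, f) k.
have -> : bern_mean 2^-1 (fun e => sup_abs G' (fun q =>
      \sum_k ((-1) ^+ e k * (z k)%:R) * column b q k)) =
    bern_mean 2^-1 (fun e => sup_abs G' (fun q => rad_sum (v q.1 q.2) e)).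
  apply: eq_bern_mean => e; congr (sup_abs _ _); apply/funext => -[m f].
  by apply: eq_bigr => k _; rewrite -mulrA.
set S := Num.sqrt (rad2 z); have S0 : 0 <= S by exact: sqrtr_ge0.
have SS : S ^+ 2 = rad2 z by rewrite sqr_sqrtr.
have v_bnd m f : G f -> \sum_k v m f k ^+ 2 <= (L * S) ^+ 2.
  move=> Gf; rewrite exprMn SS.
  apply: le_trans (ler_wpM2l (sqr_ge0 L) (@rad2_ub z (m, f) Gf)).
  rewrite mulr_sumr; apply: ler_sum => k _; rewrite /v /column/=.
  case: (z k) (b_bnd f k Gf) => [/(_ isT) h|_]; last by rewrite !mul0r mulr0 expr0n.
  by case: eqP => _; rewrite ?mul1r// !mul0r expr0n mulr0.
have v_lip m f g : G f -> G g -> \sum_k (v m f k - v m g k) ^+ 2 <= L ^+ 2 * dist2 z f g.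
  move=> Gf Gg; rewrite mulr_sumr; apply: ler_sum => k _; rewrite /v /column/=.
  case: (z k) (b_lip f g k Gf Gg) => [/(_ isT) h|_].
    by case: eqP => _; rewrite !mul1r// !mul0r subrr expr0n mulr_ge0 ?sqr_ge0.
  by rewrite !mul0r subrr expr0n mulr0.
have D2tri f g h : dist2 z g h <= 2 * (dist2 z f g + dist2 z f h).
  rewrite /dist2 -big_split/= mulr_sumr; apply: ler_sum => k _.
  rewrite -mulrDr [2 * _]mulrCA; apply: ler_wpM2l => //.
  set a := ev f _; set a1 := ev g _; set a2 := ev h _.
  by have := sqr_ge0 ((a - a1) + (a - a2)); nra.
have lam0 : 0 <= lam by exact: sqrtr_ge0.
have rhs0 : 0 <= 48 * L * lam * J * (Num.sqrt (env2 z) + S / delta).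
  apply: mulr_ge0; first by rewrite !mulr_ge0.
  by apply: addr_ge0; [exact: sqrtr_ge0|exact: divr_ge0 (ltW _)].
have [S_eq0|S_neq0] := eqVneq S 0.
  apply: le_trans rhs0; rewrite -[leRHS](bern_mean_cst K 2^-1).
  apply: ler_bern_mean; first by apply/andP; split; lra.
  move=> e; apply: sup_abs_le => // -[m f] /= Gf.
  apply: (le_trans (ler_norm_rad_sum _ _)); rewrite big1// => k _.
  apply/eqP; rewrite normr_eq0 -sqrf_eq0 eq_le sqr_ge0 andbT.
  apply: (@le_trans _ _ ((L * S) ^+ 2)); last by rewrite S_eq0 mulr0 expr0n.
  apply: le_trans (v_bnd m f Gf); rewrite (bigD1 k)//= lerDl.
  by apply: sumr_ge0 => i _; exact: sqr_ge0.
have {S_neq0}S_gt0 : 0 < S by rewrite lt_def S_neq0.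
have env_gt0 : 0 < env2 z by apply: lt_le_trans (rad2_env z); rewrite -SS exprn_gt0.
set g := Num.sqrt (env2 z); have g_gt0 : 0 < g by rewrite sqrtr_gt0.
have gg : g ^+ 2 = env2 z by rewrite sqr_sqrtr// ltW.
pose t := S / g; have t0 : 0 < t by rewrite divr_gt0.
have eps0 j : 0 < 2^-1 ^+ j * t by rewrite mulr_gt0// exprn_gt0// invr_gt0.
pose n j := projT1 (cid (phi_cover env_gt0 (eps0 j))).
have cP j := projT2 (cid (phi_cover env_gt0 (eps0 j))).
pose c j : 'I_(n j) -> T := projT1 (cid (cP j)).
have ccP j := projT2 (cid (cP j)).
apply: le_trans (@chaining_sup R K T G M v (dist2 z) L S (2 * J * (1 + t / delta) / t) n c
  (fun j => phi (2^-1 ^+ j * t)) M0 G0 L0 S0 D2tri v_lip v_bnd _ _ _ _ _) _.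
- by move=> j i; have [h _ _] := ccP j; exact: h.
- move=> j f Gf; have [_ /(_ f Gf)[i ci] _] := ccP j; exists i.
  apply: (le_trans ci); rewrite -gg -exprMn /t -mulrA divfK// gt_eqF//.
- by move=> j; have [] := ccP j.
- move=> j; apply: phi_mono; first exact: eps0.
  by rewrite exprS -mulrA; apply: ler_piMl; [exact: ltW (eps0 j)|lra].
- move=> m; rewrite ler_pdivlMr// mulr_suml; apply: le_trans (phi_sum m t0).
  by apply: ler_sum => j _; rewrite mulrAC.
rewrite -/lam le_eqVlt; apply/orP; left; apply/eqP; rewrite /t; field.
by rewrite !gt_eqF.
Qed.

Let envmax_ub (z : obs) k : (z k)%:R * Fv k.1 <= envmax z.
Proof.
case: k => i m /=; apply: le_trans (le_bigmax _ _ i).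
exact: (le_bigmax _ (fun m => (z (i, m))%:R * Fv i) m).
Qed.

Let envmax_ge0 z : 0 <= envmax z.
Proof. exact: bigmax_ge_id. Qed.

(** On the selected points [a ^+ 2 - c ^+ 2 = (a - c) * (a + c)] and both functions
are at most [envmax z], so that the process of squares inherits the covers of the
process itself. *)
Lemma rademacher_sqr_bound (z : obs) :
  bern_mean 2^-1 (fun e => sup_abs G' (fun q =>
    \sum_k ((-1) ^+ e k * (z k)%:R) * column (fun t i => ev t i ^+ 2) q k)) <=
  96 * lam * J * (envmax z * (Num.sqrt (env2 z) + Num.sqrt (rad2 z) / delta)).
Proof.
have Fz f k : G f -> z k -> `|ev f k.1| <= envmax z.
  by move=> Gf zk; apply: (le_trans (evF _ Gf)); have := envmax_ub z k; rewrite zk mul1r.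
apply: le_trans (@rademacher_bound z (fun t i => ev t i ^+ 2) (2 * envmax z) _ _ _) _.
- by rewrite mulr_ge0.
- move=> f g k Gf Gg zk; rewrite subr_sqr exprMn mulrC ler_wpM2r ?sqr_ge0//.
  apply: sq_le; first by rewrite mulr_ge0.
  by apply: (le_trans (ler_normD _ _)); have := Fz f k Gf zk; have := Fz g k Gg zk; lra.
- move=> f k Gf zk; rewrite [leLHS]exprS expr1 ler_wpM2r ?sqr_ge0//.
  apply: sq_le; first by rewrite mulr_ge0.
  by have := Fz f k Gf zk; have := envmax_ge0 z; lra.
by rewrite le_eqVlt; apply/orP; left; apply/eqP; ring.
Qed.

Let quadratic (B a c : R) : 0 <= a -> 0 <= c -> B ^+ 2 <= c + a * B ->
  B <= a + Num.sqrt c.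
Proof.
move=> a0 c0 h; rewrite leNgt; apply/negP => hB.
have s0 : 0 <= Num.sqrt c by exact: sqrtr_ge0.
have := sqr_sqrtr c0; nra.
Qed.

Let mean_env2 : bern_mean p env2 = N%:R * (M%:R * (#|I|%:R^-1 * \sum_i Fv i ^+ 2)).
Proof.
rewrite /env2 bern_mean_sum.
rewrite (eq_bigr (fun k : K => p * Fv k.1 ^+ 2)); last first.
  move=> k _; transitivity (Fv k.1 ^+ 2 * bern_mean p (fun z : obs => (z k)%:R)).
    by rewrite -bern_meanZ; apply: eq_bern_mean => z; rewrite mulrC.
  by rewrite bern_mean_coord mulrC.
rewrite -(pair_bigA _ (fun i m => p * Fv i ^+ 2))/=.
under eq_bigr do rewrite sumr_const card_ord -[_ *+ M]mulr_natr.
by rewrite -mulr_suml -mulr_sumr; ring.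
Qed.

Let env2_ge0 z : 0 <= env2 z.
Proof. exact: le_trans (rad2_env z). Qed.

Let column_le (b : T -> I -> R) (q : 'I_M * T) k (c : R) :
  `|b q.2 k.1| <= c -> `|column b q k| <= c.
Proof.
move=> bc; rewrite /column; case: eqP => _; rewrite ?mul1r//.
by rewrite mul0r normr0 (le_trans _ bc).
Qed.

Let column_sqr_le (q : 'I_M * T) k : G' q ->
  `|column (fun t i => ev t i ^+ 2) q k| <= Fv k.1 ^+ 2.
Proof.
move=> Gq; apply: column_le; rewrite ger0_norm ?sqr_ge0//.
by apply: sq_le => //; exact: evF.
Qed.

Local Notation process := (fun z : obs =>
  sup_abs G' (fun q => \sum_k ((z k)%:R - p) * column ev q k)).
Local Notation mean_env := (Num.sqrt (bern_mean p env2)).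
Local Notation mean_rad := (Num.sqrt (bern_mean p rad2)).
Local Notation mean_top := (Num.sqrt (bern_mean p (fun z => envmax z ^+ 2))).

Lemma mean_process_le :
  bern_mean p process <= 96 * lam * J * (mean_env + mean_rad / delta).
Proof.
have lam0 : 0 <= lam by exact: sqrtr_ge0.
apply: (le_trans (symmetrization (b := fun k => Fv k.1) G'0 _ p01)) => //.
apply: (@le_trans _ _ (2 * bern_mean p (fun z =>
    48 * lam * J * (Num.sqrt (env2 z) + Num.sqrt (rad2 z) / delta)))).
  rewrite ler_pM2l//; apply: ler_bern_mean => // z.
  by rewrite -[48]mulr1; apply: rademacher_bound => // *; rewrite expr1n mul1r.
rewrite bern_meanZ mulrA [2 * _](_ : _ = 96 * lam * J); last by ring.
rewrite ler_wpM2l ?mulr_ge0// bern_meanD; apply: lerD; first exact: bern_mean_sqrt_le.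
under eq_bern_mean do rewrite mulrC.
rewrite bern_meanZ mulrC; apply: ler_wpM2r; first by rewrite invr_ge0 ltW.
exact: bern_mean_sqrt_le.
Qed.

(** The uncentered sum of the squares in a group is [p] times the sum over all the
observations, that is, at most [N%:R * Delta]. *)
Let rad2_le z : rad2 z <= N%:R * Delta +
  sup_abs G' (fun q => \sum_k ((z k)%:R - p) * column (fun t i => ev t i ^+ 2) q k).
Proof.
pose col2 := column (fun t i => ev t i ^+ 2).
apply: sup_abs_le => // -[m t] Gt; rewrite ger0_norm; last first.
  by apply: sumr_ge0 => k _; rewrite mulr_ge0 ?sqr_ge0.
have colE k : column ev (m, t) k ^+ 2 = col2 (m, t) k.
  by rewrite /col2 /column/=; case: eqP => _; rewrite ?mul1r// !mul0r expr0n.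
rewrite [leLHS](_ : _ = p * \sum_k col2 (m, t) k +
    \sum_k ((z k)%:R - p) * col2 (m, t) k); last first.
  by rewrite mulr_sumr -big_split/=; apply: eq_bigr => k _; rewrite colE; ring.
apply: lerD.
  rewrite [X in p * X](_ : _ = \sum_i ev t i ^+ 2).
    by rewrite -mulrA ler_pM2l ?ltr0n//; exact: Delta_ub.
  have := sum_column (fun=> 1) (fun t i => ev t i ^+ 2) m t.
  rewrite (eq_bigr (fun k => col2 (m, t) k)) => [->|k _]; last by rewrite mul1r.
  by apply: eq_bigr => i _; rewrite mul1r.
apply: le_trans (ler_norm _) _.
apply: (@sup_abs_ub _ _ G' (fun q => \sum_k ((z k)%:R - p) * col2 q k)
  (\sum_k `|(z k)%:R - p| * Fv k.1 ^+ 2) (m, t)) => //.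
move=> q Gq; apply: (le_trans (ler_norm_sum _ _ _)); apply: ler_sum => k _.
by rewrite normrM ler_wpM2l// column_sqr_le.
Qed.

(** The mean squared radius is bounded in terms of its own square root: this is the
quadratic inequality solved in [conditional_bound]. *)
Lemma mean_rad2_le : bern_mean p rad2 <=
  N%:R * Delta + 192 * lam * J * (mean_top * (mean_env + mean_rad / delta)).
Proof.
have lam0 : 0 <= lam by exact: sqrtr_ge0.
apply: (le_trans (ler_bern_mean p01 rad2_le)).
rewrite bern_meanD bern_mean_cst lerD2l.
apply: (le_trans (symmetrization (b := fun k => Fv k.1 ^+ 2) G'0 _ p01)) => //.
apply: (@le_trans _ _ (2 * bern_mean p (fun z =>
    96 * lam * J * (envmax z * (Num.sqrt (env2 z) + Num.sqrt (rad2 z) / delta))))).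
  by rewrite ler_pM2l//; apply: ler_bern_mean => // z; exact: rademacher_sqr_bound.
rewrite bern_meanZ mulrA [2 * _](_ : _ = 192 * lam * J); last by ring.
rewrite ler_wpM2l ?mulr_ge0// mulrDr.
rewrite (@eq_bern_mean _ _ _ _ (fun z => envmax z * Num.sqrt (env2 z) +
   delta^-1 * (envmax z * Num.sqrt (rad2 z)))); last by move=> z; ring.
have sqrtK (h : obs -> R) : (forall z, 0 <= h z) ->
    bern_mean p (fun z => Num.sqrt (h z) ^+ 2) = bern_mean p h.
  by move=> h0; apply: eq_bern_mean => z; rewrite sqr_sqrtr.
rewrite bern_meanD bern_meanZ; apply: lerD.
  have := bern_mean_cauchy_schwarz envmax (fun z => Num.sqrt (env2 z)) p01.
  by rewrite sqrtK.
rewrite mulrA [leRHS]mulrC; apply: ler_wpM2l; first by rewrite invr_ge0 ltW.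
have := bern_mean_cauchy_schwarz envmax (fun z => Num.sqrt (rad2 z)) p01.
by rewrite sqrtK.
Qed.

(** Solving the quadratic inequality for [B], the root mean square of the radius,
gives [B <= 2 * a + sqrt (N * Delta) + delta * h], with [h] the root mean square of
the norm of the envelope; inserted in [mean_process_le], the three summands become
the second, the third and the first term. The largest constant that occurs is
[192 ^+ 2]. *)
Lemma conditional_bound :
  (Num.sqrt N%:R)^-1 * bern_mean p process <=
  200 ^+ 2 * (lam * J * Num.sqrt (M%:R * (#|I|%:R^-1 * \sum_i Fv i ^+ 2)) +
    lam ^+ 2 * mean_top * (Num.sqrt N%:R)^-1 * (J ^+ 2 / delta ^+ 2) +
    Num.sqrt Delta * lam * (J / delta)).
Proof.
set E2 := M%:R * _; set top := mean_top; set B := mean_rad.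
set g := Num.sqrt E2; set sN := Num.sqrt N%:R.
have lam0 : 0 <= lam by exact: sqrtr_ge0.
have sN0 : 0 < sN by rewrite sqrtr_gt0 ltr0n.
have E20 : 0 <= E2.
  by rewrite !mulr_ge0 ?invr_ge0//; apply: sumr_ge0 => i _; exact: sqr_ge0.
have top0 : 0 <= top by exact: sqrtr_ge0.
have g0 : 0 <= g by exact: sqrtr_ge0.
have Delta0 : 0 <= Delta.
  have [t Gt] := G0; apply: le_trans (Delta_ub Gt).
  by rewrite mulr_ge0 ?invr_ge0//; apply: sumr_ge0 => i _; exact: sqr_ge0.
have sD0 : 0 <= Num.sqrt Delta by exact: sqrtr_ge0.
have envE : mean_env = sN * g.
  by rewrite mean_env2 -/E2 sqrtrM.
have BB_le : B ^+ 2 <= N%:R * Delta + 192 * lam * J * (top * (sN * g + B / delta)).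
  by rewrite sqr_sqrtr ?bern_mean_ge0// -envE; exact: mean_rad2_le.
set h := sN * g in BB_le *; have h0 : 0 <= h by rewrite mulr_ge0// ltW.
pose a := 192 * lam * J * top / delta.
have a0 : 0 <= a by rewrite /a !mulr_ge0// invr_ge0 ltW.
have B_le : B <= 2 * a + sN * Num.sqrt Delta + delta * h.
  have c0 : 0 <= N%:R * Delta + a * (delta * h).
    apply: addr_ge0; first exact: mulr_ge0.
    by apply: mulr_ge0 => //; apply: mulr_ge0 => //; exact: ltW.
  apply: (@le_trans _ _ (a + Num.sqrt (N%:R * Delta + a * (delta * h)))).
    apply: quadratic => //; apply: (le_trans BB_le).
    by rewrite /a le_eqVlt; apply/orP; left; apply/eqP; field; rewrite gt_eqF.
  suff : Num.sqrt (N%:R * Delta + a * (delta * h)) <=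
    a + sN * Num.sqrt Delta + delta * h by lra.
  have dh0 : 0 <= delta * h by rewrite mulr_ge0// ltW.
  have sND0 : 0 <= sN * Num.sqrt Delta by rewrite mulr_ge0// ltW.
  apply: sqrt_le_of_sqr; first by rewrite !addr_ge0.
  rewrite [N%:R * _](_ : _ = (sN * Num.sqrt Delta) ^+ 2); last by rewrite exprMn !sqr_sqrtr.
  move: a0 dh0 sND0; set x := sN * _; set y := delta * h; move=> *; nra.
rewrite ler_pdivrMl//; apply: (le_trans mean_process_le); rewrite envE.
apply: (@le_trans _ _ (96 * lam * J *
    (h + (2 * a + sN * Num.sqrt Delta + delta * h) / delta))).
  rewrite ler_wpM2l ?mulr_ge0// lerD2l; apply: ler_wpM2r => //.
  by rewrite invr_ge0 ltW.
have x1 : 0 <= lam * J * h by apply: mulr_ge0 => //; exact: mulr_ge0.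
have x2 : 0 <= lam * J * (sN * Num.sqrt Delta) / delta.
  by apply: divr_ge0; [rewrite !mulr_ge0// ltW|exact: ltW].
have x3 : 0 <= lam ^+ 2 * J ^+ 2 * top / delta ^+ 2.
  by rewrite !mulr_ge0 ?sqr_ge0// invr_ge0 sqr_ge0.
rewrite [leRHS](_ : _ = 200 ^+ 2 * (lam * J * h) +
   200 ^+ 2 * (lam ^+ 2 * J ^+ 2 * top / delta ^+ 2) +
   200 ^+ 2 * (lam * J * (sN * Num.sqrt Delta) / delta)); last first.
  by rewrite /h; field; rewrite !gt_eqF.
rewrite [leLHS](_ : _ = 192 * (lam * J * h) +
   192 ^+ 2 * (lam ^+ 2 * J ^+ 2 * top / delta ^+ 2) +
   96 * (lam * J * (sN * Num.sqrt Delta) / delta)); last first.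
  by rewrite /a; field; rewrite !gt_eqF.
lra.
Qed.

End conditional.

Local Open Scope ereal_scope.

(** * Entropy integrals *)
Section nonincreasing_integral.
Context (R : realType) (g : R -> \bar R).
Hypothesis g_ni : forall x y, (x <= y)%R -> g y <= g x.
Hypothesis g0 : forall x, 0 <= g x.

Lemma nonincreasing_emeasurable (D : set R) : measurable D -> measurable_fun D g.
Proof.
move=> mD; apply: (measurability _ (ErealGenCInfty.measurableE R)) => //.
move=> /= _ [_ [r ->] <-]; apply: measurableI => //.
apply: is_interval_measurable => s t/=.
rewrite !in_itv/= !andbT => fs ft u /andP[su ut].
by rewrite in_itv/= andbT (le_trans ft)// g_ni.
Qed.

Let half_gt0 j : (0 < 2^-1 ^+ j :> R)%R.
Proof. by rewrite exprn_gt0// invr_gt0. Qed.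

(** The values at the right ends of the dyadic intervals bound a nonincreasing
function from below; the interval that ends at [2^-1 ^+ j.+1 * t] has half that
length, whence the factor [2]. *)
Lemma dyadic_sum_le_integral (t : R) m : (0 < t)%R ->
  \sum_(j < m) (2^-1 ^+ j.+1 * t)%:E * g (2^-1 ^+ j.+1 * t)%R <=
  2%:E * \int[lebesgue_measure]_(x in `[0%R, t]) g x.
Proof.
move=> t0.
pose D j : set R := `](2^-1 ^+ j.+2 * t)%R, (2^-1 ^+ j.+1 * t)%R]%classic.
have mD j : measurable (D j) by exact: measurable_itv.
have tD : trivIset setT D.
  apply: ltn_trivIset => j i ij; apply/seteqP; split => // x [].
  rewrite /D/= !in_itv/= => /andP[xi _] /andP[_ xj].
  have : (2^-1 ^+ j.+1 <= 2^-1 ^+ i.+2 :> R)%R.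
    by rewrite ler_wiXn2l ?invr_ge0// ?invf_le1// ?ler1n.
  move=> /(ler_wpM2r (ltW t0)) => h.
  by have := lt_le_trans xi (le_trans xj h); rewrite ltxx.
have muD j : lebesgue_measure (D j) = (2^-1 ^+ j.+2 * t)%:E.
  rewrite /D lebesgue_measure_itv/= lte_fin ltr_pM2r// ifT.
    by rewrite -EFinB; congr EFin; rewrite [(_ ^+ j.+2)%R]exprS; field.
  by rewrite [ltLHS]exprS gtr_pMl// invf_lt1// ltr1n.
have DS j : D j `<=` `[0%R, t]%classic.
  move=> x; rewrite /D/= !in_itv/= => /andP[x1 x2]; apply/andP; split.
    by apply: le_trans (ltW x1); rewrite mulr_ge0 ?ltW.
  apply: (le_trans x2); rewrite ler_piMl ?(ltW t0)//.
  by rewrite exprn_ile1// ?invr_ge0// invf_le1// ler1n.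
apply: (@le_trans _ _
    (2%:E * \int[lebesgue_measure]_(x in \big[setU/set0]_(j <- iota 0 m) D j) g x)).
  rewrite ge0_integral_bigsetU//; last 3 first.
  - exact: iota_uniq.
  - exact: sub_trivIset tD.
  - by apply: nonincreasing_emeasurable; exact: bigsetU_measurable.
  rewrite ge0_sume_distrr; last by move=> j _; exact: integral_ge0.
  rewrite -(big_mkord xpredT (fun j => (2^-1 ^+ j.+1 * t)%:E * g (2^-1 ^+ j.+1 * t)%R)).
  rewrite /index_iota subn0.
  apply: lee_sum => j _.
  apply: (@le_trans _ _
      (2%:E * \int[lebesgue_measure]_(x in D j) cst (g (2^-1 ^+ j.+1 * t)%R) x)).
    rewrite integral_cst; last exact: mD.
    rewrite [X in _ * (_ * X)](_ : _ = (2^-1 ^+ j.+2 * t)%:E); last exact: muD.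
    rewrite muleCA -EFinM muleC le_eqVlt; apply/orP; left; apply/eqP.
    by congr (_ * _%:E); rewrite [(_ ^+ j.+2)%R]exprS; field.
  rewrite lee_pmul2l//; apply: ge0_le_integral.
  - exact: mD.
  - by move=> x _; exact: g0.
  - exact: measurable_cst.
  - by apply: nonincreasing_emeasurable; exact: mD.
  - by move=> x; rewrite /D/= in_itv/= => /andP[_ xj]; exact: g_ni.
rewrite lee_pmul2l//; apply: ge0_subset_integral => //.
- by apply: bigsetU_measurable => j _; exact: mD.
- exact: nonincreasing_emeasurable.
- by rewrite -bigcup_seq; apply: bigcup_sub => j _; exact: DS.
Qed.

(** An infinite value at [x] is also taken to the left of [x], and makes the integral
over every interval [[0, t]] infinite. *)
Lemma nonincreasing_finite (t : R) : (0 < t)%R ->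
  \int[lebesgue_measure]_(x in `[0%R, t]) g x < +oo ->
  forall x, (0 < x)%R -> g x < +oo.
Proof.
move=> t0 gt x x0; rewrite ltey; apply/negP => /eqP gx.
pose u := Num.min x t; have u0 : (0 < u)%R by rewrite lt_min x0.
have gu : g u = +oo by apply/eqP; rewrite -leye_eq -gx g_ni// ge_min lexx.
have := @dyadic_sum_le_integral u 1 u0.
rewrite big_ord1 (_ : g _ = +oo); last first.
  by apply/eqP; rewrite -leye_eq -gu g_ni// expr1 ler_piMl ?ltW// invf_lt1// ltr1n.
rewrite gt0_muley ?lte_fin ?mulr_gt0//; apply/negP; rewrite -ltNge.
apply: (@le_lt_trans _ _ (2%:E * \int[lebesgue_measure]_(x in `[0%R, t]) g x)).
  rewrite lee_pmul2l//; apply: ge0_subset_integral => //.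
  - exact: nonincreasing_emeasurable.
  - by apply: subset_itvl; rewrite bnd_simp ge_min lexx orbT.
by rewrite lte_mul_pinfty.
Qed.

End nonincreasing_integral.

Lemma le_lne (R : realType) (x y : \bar R) : x <= y -> lne x <= lne y.
Proof.
move=> xy; have [x0|x0] := leP x 0; first by rewrite (le0_lneNy x0) leNye.
by rewrite lee_lne ?in_itv/= ?leey ?andbT ?(ltW x0)// (le_trans (ltW x0)).
Qed.

Lemma le_sqrte (R : realType) (x y : \bar R) : x <= y -> sqrte x <= sqrte y.
Proof.
move=> xy; have [y0|y0] := leP 0 y; first by rewrite lee_sqrt.
suff -> : sqrte x = 0 by exact: sqrte_ge0.
have := le_lt_trans xy y0; case: x {xy} => [r| |]//; rewrite lte_fin => r0.
by rewrite /= ler0_sqrtr// ltW.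
Qed.

Section Lnorm2.
Context d (T : measurableType d) (R : realType).

Lemma Lnorm2E (mu : {measure set T -> \bar R}) (f : T -> R) :
  'N[mu]_2%:E [EFin \o f] = sqrte (\int[mu]_x (f x ^+ 2)%:E).
Proof.
rewrite unlock poweR12_sqrt; last by apply: integral_ge0 => x _; exact: poweR_ge0.
congr sqrte; apply: eq_integral => x _ /=.
by rewrite powR_mulrn// real_normK// num_real.
Qed.

(** A sum of weighted Dirac masses of total mass one is unchanged by normalization,
which makes it a probability. *)
Lemma finitely_supported_prob (I : finType) (v : I -> R) (x : I -> T) :
  (forall i, 0 <= v i)%R -> (\sum_i v i = 1)%R ->
  exists Q : probability T R, finitely_supported Q /\
    forall f : T -> R, measurable_fun setT f -> (forall t, 0 <= f t)%R ->
      \int[Q]_t (f t)%:E = (\sum_i v i * f (x i))%:E.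
Proof.
move=> v0 v1.
have [i0 _] : exists i : I, true.
  have [i _|I0] := pickP (@predT I); first by exists i.
  by move: v1; rewrite big_pred0// => /eqP; rewrite eq_sym oner_eq0.
pose w j : {nonneg R} := NngNum (v0 (nth i0 (enum I) j)).
pose mu : {measure set T -> \bar R} :=
  msum (fun j => mscale (w j) \d_(x (nth i0 (enum I) j))) #|I|.
have sumE (h : I -> \bar R) : \sum_(j < #|I|) h (nth i0 (enum I) j) = \sum_i h i.
  rewrite [RHS](reindex (@enum_val _ predT)); last first.
    by exists enum_rank => ? _; rewrite ?enum_valK ?enum_rankK.
  by apply: eq_bigr => j _; rewrite (enum_val_nth i0).
have muE A : mu A = \sum_i (v i)%:E * \d_(x i) A.
  exact: (sumE (fun i => (v i)%:E * \d_(x i) A)).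
have mu1 : mu setT = 1.
  rewrite muE -[RHS]/(1%R%:E) -v1 -sumEFin; apply: eq_bigr => i _.
  by rewrite diracT mule1.
exists (mnormalize mu \d_(x i0)).
have QE A : mnormalize mu \d_(x i0) A = mu A.
  by rewrite /mnormalize mu1/= onee_eq0/= invr1 mule1.
split.
  exists #|I|, (fun j => v (enum_val j)), (fun j => x (enum_val j)); split => // A mA.
  transitivity (mu A); first exact: QE.
  by apply: eq_bigr => j _; rewrite /mscale/= !(enum_val_nth i0).
move=> f mf f0; rewrite (@eq_measure_integral _ _ _ _ mu); last by move=> A _ _; exact: QE.
rewrite ge0_integral_measure_sum//; last first.
- exact/measurable_EFinP.
- by move=> t _; rewrite lee_fin.
rewrite -sumEFin -sumE; apply: eq_bigr => j _.
rewrite ge0_integral_mscale//; last first.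
- by move=> t _; rewrite lee_fin.
- exact/measurable_EFinP.
rewrite integral_dirac//; last exact/measurable_EFinP.
by rewrite diracT mul1e.
Qed.

End Lnorm2.

Section entropy_facts.
Context d (T : measurableType d) (R : realType) (FF : set (T -> R)) (F : T -> R).

(** The integrand of [Jbar]. *)
Definition entropy (eps : R) : \bar R :=
  sqrte (1 + ereal_sup [set lne (scaled_covering FF F Q eps) |
                           Q in @finitely_supported _ T R]).

Lemma entropy_ge0 eps : 0 <= entropy eps.
Proof. exact: sqrte_ge0. Qed.

Lemma entropy_nonincreasing (x y : R) : (x <= y)%R -> entropy y <= entropy x.
Proof.
move=> xy; apply/le_sqrte/leeD2l/ge_ereal_sup => _ [Q fQ <-].
apply: le_trans (ereal_sup_ubound _); last by exists Q.
apply/le_lne/ereal_inf_le_tmp => _ [n [c [cF cover]] <-].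
exists n => //; exists c; split => // f Ff; have [i fi] := cover f Ff; exists i.
by apply: (le_trans fi); rewrite lee_wpmul2r// ?Lnorm_ge0// lee_fin.
Qed.

(** A finite covering number is attained, being an infimum of natural numbers; the
norms of the finitely supported probability are written out as weighted sums. *)
Lemma entropy_cover (I : finType) (v : I -> R) (x : I -> T) (eps : R) :
  (forall f, FF f -> measurable_fun setT f) -> measurable_fun setT F ->
  (forall i, 0 <= v i)%R -> (\sum_i v i = 1)%R -> (0 < eps)%R ->
  FF !=set0 -> entropy eps < +oo ->
  exists n (c : 'I_n -> T -> R), [/\ forall i, FF (c i),
    forall f, FF f -> exists i,
      (\sum_j v j * (f (x j) - c i (x j)) ^+ 2 <=
       eps ^+ 2 * \sum_j v j * F (x j) ^+ 2)%R
    & (Num.sqrt (1 + ln n%:R) <= fine (entropy eps))%R].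
Proof.
move=> mFF mF v0 v1 eps0 [f0 Ff0] Hoo.
have [Q [fQ QE]] := finitely_supported_prob x v0 v1.
have NQ f : measurable_fun setT f ->
    'N[Q]_2%:E [EFin \o f] = (Num.sqrt (\sum_j v j * f (x j) ^+ 2))%:E.
  move=> mf; rewrite Lnorm2E QE//; first exact: measurable_funX.
  by move=> t; exact: sqr_ge0.
pose A := [set k : nat | exists c : 'I_k -> (T -> R), (forall i, FF (c i)) /\
    (forall t, FF t -> exists i, 'N[Q]_2%:E [EFin \o (t \- c i)%R] <=
      eps%:E * 'N[Q]_2%:E [EFin \o F])].
have covE : scaled_covering FF F Q eps = ereal_inf [set k%:R%:E | k in A] by [].
have leH : sqrte (1 + lne (scaled_covering FF F Q eps)) <= entropy eps.
  by apply/le_sqrte/leeD2l/ereal_sup_ubound; exists Q.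
have A0 : exists k, `[< A k >].
  apply: contrapT => nA.
  have A_eq0 : [set k%:R%:E | k in A] = set0 :> set (\bar R).
    by apply/seteqP; split => // y [k Ak _]; apply: nA; exists k; exact/asboolP.
  by move: leH Hoo; rewrite covE A_eq0 ereal_inf0/= => /le_lt_trans h /h; rewrite ltxx.
case: (ex_minnP A0) => n /asboolP[c [cF cover]] nmin.
exists n, c; split => // [f Ff|].
  have [i] := cover f Ff; rewrite NQ; last by apply: measurable_funB; exact: mFF.
  rewrite NQ// -EFinM lee_fin => fi; exists i.
  have s0 (h : T -> R) : (0 <= \sum_j v j * h (x j) ^+ 2)%R.
    by apply: sumr_ge0 => j _; rewrite mulr_ge0// sqr_ge0.
  move: fi; rewrite -(ler_pXn2r (n := 2))// ?nnegrE ?sqrtr_ge0//; last first.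
    by rewrite mulr_ge0 ?sqrtr_ge0// ltW.
  by rewrite exprMn !sqr_sqrtr.
have n_gt0 : (0 < n)%N by have [i _] := cover f0 Ff0; case: n i {c cF cover nmin} => // -[].
have {}leH : sqrte (1 + lne n%:R%:E) <= entropy eps.
  apply: le_trans leH; apply/le_sqrte/leeD2l/le_lne.
  rewrite covE; apply: le_ereal_inf_tmp => _ [k Ak <-].
  by rewrite lee_fin ler_nat nmin//; exact/asboolP.
move: leH; rewrite lne_EFin ?ltr0n//= -lee_fin fineK//.
by rewrite ge0_fin_numE// entropy_ge0.
Qed.

End entropy_facts.

Section entropy_integral.
Context d (T : measurableType d) (R : realType) (FF : set (T -> R)) (F : T -> R).

Lemma JbarE tau : Jbar FF F tau = \int[lebesgue_measure]_(x in `[0%R, tau]) entropy FF F x.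
Proof. by []. Qed.

Lemma Jbar_ge0 tau : 0 <= Jbar FF F tau.
Proof. by apply: integral_ge0 => x _; exact: entropy_ge0. Qed.

Lemma measurable_entropy (D : set R) : measurable D -> measurable_fun D (entropy FF F).
Proof. exact: (@nonincreasing_emeasurable R _ (entropy_nonincreasing FF F)). Qed.

Lemma entropy_fin (delta : R) : (0 < delta)%R -> Jbar FF F delta < +oo ->
  forall x, (0 < x)%R -> entropy FF F x < +oo.
Proof.
move=> d0; apply: (@nonincreasing_finite R (entropy FF F) _ _ delta d0).
  exact: entropy_nonincreasing.
exact: entropy_ge0.
Qed.

Lemma entropy_fine (delta : R) : (0 < delta)%R -> Jbar FF F delta < +oo ->
  forall x, (0 < x)%R -> (fine (entropy FF F x))%:E = entropy FF F x.
Proof.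
move=> d0 J x x0; rewrite fineK// ge0_fin_numE ?entropy_ge0//.
exact: (entropy_fin d0).
Qed.

Lemma fine_entropy_mono (delta : R) : (0 < delta)%R -> Jbar FF F delta < +oo ->
  forall x y, (0 < x)%R -> (x <= y)%R ->
  (fine (entropy FF F y) <= fine (entropy FF F x))%R.
Proof.
move=> d0 J x y x0 xy; have ex := entropy_fine d0 J x0.
have ey := entropy_fine d0 J (lt_le_trans x0 xy).
by rewrite -lee_fin ex ey; exact: entropy_nonincreasing.
Qed.

(** For [t <= delta] this is the comparison with the integral. For [t > delta],
monotonicity allows the values at the points below [delta] to be used instead, and
only the weights grow, linearly in [t]. *)
Lemma entropy_dyadic_sum (delta : R) : (0 < delta)%R -> Jbar FF F delta < +oo ->
  forall t m, (0 < t)%R ->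
  (\sum_(j < m) 2^-1 ^+ j.+1 * t * fine (entropy FF F (2^-1 ^+ j.+1 * t)) <=
   2 * fine (Jbar FF F delta) * (1 + t / delta))%R.
Proof.
move=> d0 Joo t m t0.
have half0 j : (0 < 2^-1 ^+ j :> R)%R by rewrite exprn_gt0// invr_gt0.
have J0 : (0 <= fine (Jbar FF F delta))%R by rewrite fine_ge0// Jbar_ge0.
have Jfin : Jbar FF F delta \is a fin_num by rewrite ge0_fin_numE ?Jbar_ge0.
have small u : (0 < u)%R -> (u <= delta)%R ->
    (\sum_(j < m) 2^-1 ^+ j.+1 * u * fine (entropy FF F (2^-1 ^+ j.+1 * u)) <=
     2 * fine (Jbar FF F delta))%R.
  move=> u0 ud; rewrite -lee_fin -sumEFin EFinM fineK//.
  have := @dyadic_sum_le_integral R (entropy FF F) (entropy_nonincreasing FF F)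
    (entropy_ge0 FF F) u m u0.
  under eq_bigr => j _ do rewrite -(entropy_fine d0 Joo) ?mulr_gt0// -EFinM.
  move=> /le_trans; apply; rewrite lee_pmul2l// JbarE; apply: ge0_subset_integral => //.
  - exact: measurable_entropy.
  - by move=> x _; exact: entropy_ge0.
  - by apply: subset_itvl; rewrite bnd_simp.
have [td|dt] := leP t delta.
  apply: (le_trans (small _ t0 td)); rewrite -[leLHS]mulr1 ler_wpM2l ?mulr_ge0//.
  by rewrite lerDl divr_ge0 ?ltW.
apply: (@le_trans _ _ (t / delta * (2 * fine (Jbar FF F delta)))%R).
  have td0 : (0 <= t / delta)%R by rewrite divr_ge0 ?ltW.
  apply: le_trans (ler_wpM2l td0 (small delta d0 (lexx _))).
  rewrite mulr_sumr; apply: ler_sum => j _.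
  rewrite mulrA [(t / delta * _)%R](_ : _ = (2^-1 ^+ j.+1 * t)%R); last first.
    by field; rewrite gt_eqF.
  have small_gt0 : (0 < 2^-1 ^+ j.+1 * delta)%R by rewrite mulr_gt0.
  have small_le : (2^-1 ^+ j.+1 * delta <= 2^-1 ^+ j.+1 * t)%R by rewrite ler_pM2l// ltW.
  apply: ler_wpM2l; first by rewrite mulr_ge0// ltW.
  exact: (fine_entropy_mono d0 Joo small_gt0 small_le).
rewrite mulrC ler_wpM2l ?mulr_ge0//; lra.
Qed.

(** With [L = ln (A / tau)], the integrand at [2^-1 ^+ k.+1 * tau] is at most
[sqrt (nu * L) * (2 + k.+1)], and a point [x] with
[2^-1 ^+ k.+1 * tau < x <= 2^-1 ^+ k * tau] lies in exactly [k.+1] of the intervals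
from [0] to [2^-1 ^+ j * tau], whose lengths add up to [2 * tau]. *)
Lemma Jbar_VC (A nu tau : R) : (expR 1 <= A)%R -> (1 <= nu)%R ->
  VC_type FF F A nu -> (0 < tau <= 1)%R ->
  Jbar FF F tau <= (4 * tau * Num.sqrt (nu * ln (A / tau)))%:E.
Proof.
move=> eA nu1 VC /andP[tau0 tau1].
have A0 : (0 < A)%R by apply: lt_le_trans eA; exact: expR_gt0.
have At0 : (0 < A / tau)%R by rewrite divr_gt0.
set L := ln (A / tau).
have L1 : (1 <= L)%R.
  rewrite -[leLHS](@expRK R) ler_ln ?posrE ?expR_gt0//.
  by apply: (le_trans eA); rewrite ler_pdivlMr// ler_piMr// ltW.
have nuL1 : (1 <= nu * L)%R by rewrite -[leLHS]mulr1 ler_pM.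
have half0 j : (0 < 2^-1 ^+ j :> R)%R by rewrite exprn_gt0// invr_gt0.
pose s := Num.sqrt (nu * L); have s0 : (0 <= s)%R by exact: sqrtr_ge0.
have bnd k : entropy FF F (2^-1 ^+ k.+1 * tau) <= (s * (2 + k.+1%:R))%:E.
  set e := (2^-1 ^+ k.+1 * tau)%R; have e0 : (0 < e)%R by rewrite mulr_gt0.
  have e1 : (e < 1)%R.
    apply: (@le_lt_trans _ _ (2^-1 ^+ k.+1)%R); first by rewrite ler_piMr// ltW.
    by rewrite exprn_ilt1// ?invr_ge0// invf_lt1// ltr1n.
  have Ae0 : (0 < A / e)%R by rewrite divr_gt0.
  apply: (@le_trans _ _ (sqrte (1 + (nu * ln (A / e))%:E))).
    apply/le_sqrte/leeD2l/ge_ereal_sup => _ [Q fQ <-].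
    rewrite -ln_powR -lne_EFin ?powR_gt0//; apply: le_lne.
    have e01 : (0 < e < 1)%R by rewrite e0.
    by apply: le_trans (VC e e01); apply: ereal_sup_ubound; exists Q.
  rewrite /= lee_fin; apply: sqrt_le_of_sqr; first by rewrite mulr_ge0// addr_ge0.
  rewrite exprMn sqr_sqrtr; last by rewrite (le_trans ler01).
  have -> : ln (A / e) = (L + k.+1%:R * ln 2)%R.
    rewrite (_ : A / e = (A / tau) * 2 ^+ k.+1)%R; last first.
      by rewrite /e exprVn; field; rewrite !gt_eqF ?exprn_gt0.
    by rewrite lnM ?posrE ?exprn_gt0// lnXn// mulr_natl.
  have ln2 : (ln 2 <= 1 :> R)%R by have := @le_ln1Dx R 1 ltac:(lra); rewrite (_ : 1 + 1 = 2)%R.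
  have ln20 : (0 <= ln 2 :> R)%R by rewrite ln_ge0// ler1n.
  have k0 : (0 <= k.+1%:R :> R)%R by [].
  have h1 : (nu * (k.+1%:R * ln 2) <= nu * L * k.+1%:R)%R.
    rewrite -mulrA; apply: ler_wpM2l; first lra.
    by rewrite [leRHS]mulrC; apply: ler_wpM2l => //; lra.
  have h2 : (0 <= nu * L * k.+1%:R)%R by rewrite mulr_ge0//; lra.
  have h3 : (0 <= nu * L * k.+1%:R * k.+1%:R)%R by rewrite mulr_ge0.
  rewrite mulrDr; nra.
pose ind k (x : R) : \bar R := (\1_(`]0%R, (2^-1 ^+ k * tau)%R]%classic : set R) x)%:E.
have ind0 k x : 0 <= ind k x by rewrite lee_fin.
have pointwise x : (0 < x <= tau)%R ->
    entropy FF F x <= s%:E * (2%:E + \sum_(0 <= k <oo) ind k x).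
  move=> /andP[x0 xt].
  have [k kx] : exists k, (2^-1 ^+ k * tau < x)%R.
    have [k] := exp2_small tau (divr_gt0 x0 (@ltr0n R 2)).
    by rewrite mulrC => h; exists k; lra.
  case: (ex_minnP (ex_intro (fun k => 2^-1 ^+ k * tau < x)%R k kx)) => -[|m] mx mmin.
    by move: mx; rewrite expr0 mul1r ltNge xt.
  apply: (le_trans (entropy_nonincreasing _ _ (ltW mx))).
  apply: (le_trans (bnd m)); rewrite EFinM EFinD lee_wpmul2l ?lee_fin//.
  rewrite leeD2l//; apply: le_trans (nneseries_lim_ge m.+1 _) => //.
  rewrite big_mkord (eq_bigr (fun=> 1%:E)); last first.
    move=> i _; rewrite /ind indicE mem_set//= in_itv/= x0/= leNgt; apply/negP => /mmin.
    by rewrite leqNgt ltn_ord.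
  by rewrite sumEFin sumr_const card_ord.
(* At [0] all the indicators vanish while the entropy may be infinite. *)
rewrite JbarE -integral_itv_obnd_cbnd; last first.
  exact: measurable_entropy.
have mind k : measurable_fun setT (ind k).
  by apply/measurable_EFinP; exact: measurable_indic.
have msum : measurable_fun (`]0%R, tau]%classic : set R) (fun x => \sum_(0 <= k <oo) ind k x).
  by apply: ge0_emeasurable_sum => [k x _ _|k _]; [exact: ind0|exact: measurable_funTS].
have sum0 x : 0 <= \sum_(0 <= k <oo) ind k x by apply: nneseries_ge0.
apply: (@le_trans _ _ (\int[lebesgue_measure]_(x in `]0%R, tau])
    (s%:E * (2%:E + \sum_(0 <= k <oo) ind k x)))).
  apply: ge0_le_integral => //.
  - by move=> x _; exact: entropy_ge0.
  - exact: measurable_entropy.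
  - by apply: measurable_funeM; apply: emeasurable_funD.
rewrite ge0_integralZl//; last 2 first.
- exact: emeasurable_funD.
- by move=> x _; rewrite adde_ge0.
rewrite ge0_integralD// integral_cst//= lebesgue_measure_itv/= lte_fin tau0.
rewrite integral_nneseries; last 3 first.
- exact: measurable_itv.
- by move=> k; exact: (measurable_funTS (mind k)).
- by move=> *; exact: ind0.
rewrite [leRHS](_ : _ = s%:E * (2 * tau + 2 * tau)%:E); last first.
  by rewrite -EFinM; congr EFin; rewrite -/L -/s; ring.
rewrite [(2 * tau + 2 * tau)%:E]EFinD [X in _ <= _ * (X + _)]EFinM.
rewrite lee_wpmul2l ?lee_fin// oppr0 adde0 leeD2l//.
have int_ind k : \int[lebesgue_measure]_(x in `]0%R, tau]) ind k x <= (2^-1 ^+ k * tau)%:E.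
  rewrite integral_indic//; apply: (@le_trans _ _
    (lebesgue_measure (`]0%R, (2^-1 ^+ k * tau)%R]%classic : set R))).
    by apply: le_measure; rewrite ?inE//; exact: measurableI.
  by rewrite lebesgue_measure_itv/= lte_fin mulr_gt0// oppr0 adde0.
apply: lime_le; first by apply: is_cvg_nneseries => k _ _; exact: integral_ge0.
near=> m; apply: (@le_trans _ _ (\sum_(0 <= k < m) (2^-1 ^+ k * tau)%:E)).
  exact: lee_sum.
rewrite sumEFin lee_fin -mulr_suml ler_pM2r//.
rewrite big_mkord; have := subrX1 (2^-1 : R) m.
have := half0 m; set q := (2^-1 ^+ m)%R; set q' := (\sum_(_ < _) _)%R; lra.
Unshelve. all: by end_near.
Qed.

End entropy_integral.

(** * The law of a sample and conditioning on the selectors *)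
Section tuple_law.
Context d (S : measurableType d) (R : realType) (P : probability S R).

Definition box n (A : 'I_n -> set S) : set (n.-tuple S) :=
  [set x | forall i, A i (tnth x i)].

Lemma measurable_box n (A : 'I_n -> set S) : (forall i, measurable (A i)) ->
  measurable (box A).
Proof.
move=> mA; rewrite (_ : box A = \bigcap_(i in [set: 'I_n])
    ((@tnth n S ^~ i) @^-1` A i)); last first.
  by apply/seteqP; split => [x h i _|x h i] /=; [exact: h|exact: (h i I)].
apply: fin_bigcap_measurable => // i _.
by rewrite -[X in measurable X]setTI; exact: measurable_tnth.
Qed.

(** Boxes form a pi-system that generates the product sigma-algebra. *)
Lemma eq_tuple_measure n (m1 m2 : {measure set (n.-tuple S) -> \bar R}) :
  m1 setT < +oo ->
  (forall A : 'I_n -> set S, (forall i, measurable (A i)) -> m1 (box A) = m2 (box A)) ->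
  forall B, measurable B -> m1 B = m2 B.
Proof.
move=> m1oo m12 B mB.
pose G := [set B : set (n.-tuple S) | exists A, (forall i, measurable (A i)) /\ B = box A].
have GT : G setT.
  by exists (fun=> setT); split => //; apply/seteqP; split.
apply: (measure_unique G (fun=> setT)) => //.
- apply/seteqP; split => C.
    apply: smallest_sub; first exact: smallest_sigma_algebra.
    move=> D; rewrite -bigcup_seq => -[i _ [A mA <-]].
    apply: sub_sigma_algebra; exists (fun j => if j == i then A else setT); split.
      by move=> j; case: ifP.
    apply/seteqP; split => x /=; first by move=> [_ Ax] j; case: eqP => // ->.
    by move=> /(_ i); rewrite eqxx.
  apply: smallest_sub; first exact: sigma_algebra_measurable.
  by move=> _ [A [mA ->]]; exact: measurable_box.
- move=> _ _ [A1 [mA1 ->]] [A2 [mA2 ->]].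
  exists (fun i => A1 i `&` A2 i); split => [i|]; first exact: measurableI.
  apply/seteqP; split => x /=; first by move=> [x1 x2] i; split.
  by move=> x12; split => i; have [] := x12 i.
- by apply/seteqP; split => // x _; exists 0%N.
- by move=> _ [A [mA ->]]; exact: m12.
Qed.

End tuple_law.

Section random_sample.
Context d d' (S : measurableType d) (Omega : measurableType d') (R : realType).
Variables (P : probability S R) (Pr : probability Omega R) (n : nat).
Variable X : 'I_n -> {RV Pr >-> S}.

Definition sample (w : Omega) : n.-tuple S := [tuple X i w | i < n].

Lemma measurable_sample : measurable_fun setT sample.
Proof.
apply/measurable_fun_tnthP => i.
rewrite (_ : _ \o _ = X i); first exact: measurable_funPT.
by apply/funext => w /=; rewrite tnth_mktuple.
Qed.

Lemma sigma_sample (A : set (n.-tuple S)) : measurable A -> sigma_rv X (sample @^-1` A).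
Proof.
pose G := [set B | exists i A, measurable A /\ B = X i @^-1` A].
have [G0 GC GU] : sigma_algebra setT <<s G >> by exact: smallest_sigma_algebra.
apply: (smallest_sub (X := [set A | <<s G >> (sample @^-1` A)])).
- split => [|B /= GB|B /= GB].
  + by rewrite /= preimage_set0.
  + by rewrite setTD preimage_setC -setTD; exact: GC.
  + by rewrite preimage_bigcup; exact: GU.
- move=> D; rewrite -bigcup_seq => -[i _ [B mB <-]] /=.
  apply: sub_sigma_algebra; exists i, B; split => //.
  by apply/seteqP; split => w /=; rewrite tnth_mktuple//; case.
Qed.

(** Coordinates that are not selected by [g] are left unconstrained, so that the
product rule over all of ['I_n] yields the one over ['I_r]. *)
Lemma sample_law r (g : 'I_r -> 'I_n) : injective g ->
  (forall i A, measurable A -> distribution Pr (X i) A = P A) ->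
  mutually_independent X ->
  forall B, measurable B ->
    Pr ((fun w => [tuple tnth (sample w) (g k) | k < r]) @^-1` B) = power_prob P r B.
Proof.
move=> ginj XP Xind.
pose Y w := [tuple tnth (sample w) (g k) | k < r].
have mY : measurable_fun setT Y.
  apply/measurable_fun_tnthP => k.
  rewrite (_ : _ \o _ = X (g k)); first exact: measurable_funPT.
  by apply/funext => w /=; rewrite !tnth_mktuple.
pose Ym : {mfun Omega >-> r.-tuple S} := HB.pack Y (isMeasurableFun.Build _ _ _ _ Y mY).
apply: (@eq_tuple_measure _ _ _ r (pushforward Pr Ym)).
  by rewrite /= /pushforward preimage_setT probability_setT ltry.
move=> A mA; transitivity (\prod_(k < r) P (A k)); last first.
  by apply/esym; exact: power_prob_box.
rewrite /= /pushforward/=.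
pose A' j := if [pick k | g k == j] is Some k then A k else setT.
have A'g k : A' (g k) = A k.
  rewrite /A'; case: pickP => [k' /eqP/ginj->//|/(_ k)]; by rewrite eqxx.
rewrite (_ : _ @^-1` _ = [set w | forall j, A' j (X j w)]); last first.
  apply/seteqP; split => w /= h.
    move=> j; rewrite /A'; case: pickP => // k /eqP <-.
    by have := h k; rewrite !tnth_mktuple.
  by move=> k; rewrite !tnth_mktuple -A'g; exact: h.
rewrite Xind; last by move=> j; rewrite /A'; case: pickP.
rewrite (bigID (fun j => [exists k, g k == j]))/= [X in _ * X]big1 ?mule1; last first.
  move=> j /existsPn nj; rewrite /A'; case: pickP => [k|_]; first by rewrite (negPf (nj k)).
  by rewrite preimage_setT probability_setT.
rewrite (eq_bigl (fun j => j \in (g @: [set: 'I_r])%SET)); last first.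
  move=> j; apply/existsP/imsetP => [[k /eqP <-]|[k _ ->]]; exists k => //.
rewrite big_imset/=; last by move=> k k' _ _; exact: ginj.
rewrite (eq_bigl xpredT); last by move=> k; rewrite inE.
by apply: eq_bigr => k _; rewrite A'g -(XP (g k) (A k) (mA k)).
Qed.

End random_sample.

Section mrestr_integral.
Context d (T : measurableType d) (R : realType) (mu : {measure set T -> \bar R}).

Lemma ge0_integral_mrestr (E : set T) (mE : measurable E) (f : T -> \bar R) :
  measurable_fun setT f -> (forall x, 0 <= f x) ->
  \int[mrestr mu mE]_x f x = \int[mu]_(x in E) f x.
Proof.
move=> mf f0; rewrite -(setUv E) ge0_integral_setU//; last 3 first.
- exact: measurableC.
- by rewrite setUv.
- exact/disj_setPCl.
rewrite [X in _ + X](_ : _ = 0) ?adde0.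
  by apply: eq_measure_integral => A mA AE; rewrite /= /mrestr (setIidl AE).
rewrite -(integral_measure_zero (~` E) f); apply: eq_measure_integral => A mA AE.
rewrite /= /mrestr (_ : A `&` E = set0) ?measure0//.
by apply/disjoints_subset.
Qed.

End mrestr_integral.

Section conditioning.
Context d d' (S : measurableType d) (Omega : measurableType d') (R : realType).
Variables (Pr : probability Omega R) (n : nat) (K : finType) (p : R).
Variables (X : 'I_n -> {RV Pr >-> S}) (Z : K -> {RV Pr >-> bool}).
Hypothesis p01 : (0 <= p <= 1)%R.
Hypothesis Zlaw : forall k A, distribution Pr (Z k) A = bernoulli_prob p A.
Hypothesis Zind : mutually_independent Z.
Hypothesis XZind : independent_families X Z.

Definition selector (w : Omega) : {ffun K -> bool} := [ffun k => Z k w].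

Let E (z : {ffun K -> bool}) := [set w | forall k, Z k w = z k].

Let EP z w : E z w <-> selector w = z.
Proof.
split=> [h|<- k]; last by rewrite ffunE.
by apply/ffunP => k; rewrite ffunE.
Qed.

Let mE z : measurable (E z).
Proof.
rewrite (_ : E z = \bigcap_(k in [set: K]) (Z k @^-1` [set z k])); last first.
  by apply/seteqP; split => [w h k _|w h k] /=; [exact: h|exact: (h k I)].
apply: fin_bigcap_measurable => // k _; rewrite -[X in measurable X]setTI.
exact: (measurable_funPT (Z k)).
Qed.

Let sigmaE z : sigma_rv Z (E z).
Proof.
rewrite (_ : E z = \bigcap_(k in [set: K]) (Z k @^-1` [set z k])); last first.
  by apply/seteqP; split => [w h k _|w h k] /=; [exact: h|exact: (h k I)].
pose G := [set B | exists k A, measurable A /\ B = Z k @^-1` A].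
apply: (@fin_bigcap_measurable _ (g_sigma_algebraType G)) => // k _.
by apply: sub_sigma_algebra; exists k, [set z k].
Qed.

Let PrE z : Pr (E z) = (bern_weight p z)%:E.
Proof.
rewrite /E (Zind (A := fun k => [set z k]))// /bern_weight -prodEFin.
apply: eq_bigr => k _; rewrite -[LHS]/(distribution Pr (Z k) [set z k]) Zlaw.
rewrite bernoulli_probE// !diracE.
have in1 (a b : bool) : (a \in [set b]) = (a == b) by apply/idP/eqP; rewrite inE.
by rewrite !in1; case: (z k); rewrite /= mule1 mule0 ?adde0 ?add0e.
Qed.

(** The selectors take finitely many values. On the event that they equal [z], the law
of the sample is [bern_weight p z] times its unconditional law, by independence. *)
Lemma integral_conditioning (H : {ffun K -> bool} -> n.-tuple S -> \bar R) :
  (forall z, measurable_fun setT (H z)) -> (forall z x, 0 <= H z x) ->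
  \int[Pr]_w H (selector w) (sample X w) =
  \int[Pr]_w \sum_z (bern_weight p z)%:E * H z (sample X w).
Proof.
move=> mH H0.
have mHX z : measurable_fun setT (fun w => H z (sample X w)).
  by apply: measurableT_comp => //; exact: measurable_sample.
pose HE z := (fun w => H z (sample X w)) \_ (E z).
have split_sel w : H (selector w) (sample X w) = \sum_z HE z w.
  rewrite /HE (bigD1 (selector w))//= patchE mem_set; last exact/EP.
  rewrite big1 ?adde0// => z zw; rewrite patchE memNset// => /EP wz.
  by rewrite wz eqxx in zw.
under eq_integral do rewrite split_sel.
rewrite ge0_integral_sum//; last 2 first.
- by move=> z; apply/(measurable_restrictT _ (mE z)); exact: measurable_funTS.
- by move=> z w _; rewrite /HE patchE; case: ifP.
rewrite ge0_integral_sum//; last 2 first.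
- by move=> z; exact: measurable_funeM.
- by move=> z w _; rewrite mule_ge0// lee_fin bern_weight_ge0.
apply: eq_bigr => z _; rewrite -integral_mkcond.
rewrite ge0_integralZl//; last by rewrite lee_fin bern_weight_ge0.
rewrite -(ge0_integral_mrestr Pr (mE z))//.
have mX := measurable_sample X.
have H0' : {in setT, forall x, 0 <= H z x} by [].
have e1 := ge0_integral_pushforward mX (mrestr Pr (mE z)) measurableT (mH z) H0'.
have e2 := ge0_integral_pushforward mX Pr measurableT (mH z) H0'.
rewrite preimage_setT in e1; rewrite preimage_setT in e2.
rewrite -[LHS]e1 -[X in _ * X]e2.
rewrite -(ge0_integral_mscale _ measurableT (NngNum (bern_weight_ge0 z p01)))//.
apply: eq_measure_integral => A mA _.
rewrite /= /mscale/= /pushforward /mrestr XZind; [|exact: sigma_sample|exact: sigmaE].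
by rewrite PrE muleC.
Qed.

End conditioning.

(** * The process of the theorem for fixed data *)
Section fixed_data.
Context d (S : measurableType d) (R : realType) (r n M N : nat).
Variables (FF : set (r.-tuple S -> R)) (F : r.-tuple S -> R) (x : n.-tuple S) (delta : R).
Notation I := (incr_tuple n r).
Notation K := (I * 'I_M)%type.
Hypothesis M0 : (0 < M)%N.
Hypothesis N0 : (0 < N)%N.
Hypothesis NI : (N <= #|{: I}|)%N.
Hypothesis FF0 : FF !=set0.
Hypothesis mFF : forall f, FF f -> measurable_fun setT f.
Hypothesis mF : measurable_fun setT F.
Hypothesis FFF : forall f, FF f -> forall y, (`|f y| <= F y)%R.
Hypothesis delta0 : (0 < delta)%R.
Hypothesis Joo : Jbar FF F delta < +oo.

Notation p := (samp_prob R n r N).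
Definition uncurry_sel (z : {ffun K -> bool}) (i : I) (m : 'I_M) : bool := z (i, m).
Let ev (f : r.-tuple S -> R) (i : I) : R := f (subsample x i).

Lemma samp_prob01 : (0 <= p <= 1)%R.
Proof.
have I0 : (0 < #|{: I}|%:R :> R)%R by rewrite ltr0n (leq_trans N0).
by rewrite /samp_prob divr_ge0//= ler_pdivrMr// mul1r ler_nat.
Qed.

Let F0 y : (0 <= F y)%R.
Proof. by have [f Ff] := FF0; apply: le_trans (FFF Ff y). Qed.

Lemma max_Dn_ge0 (z : I -> 'I_M -> bool) : 0 <= max_Dn FF N x z.
Proof.
have [f Ff] := FF0; apply: le_trans (le_bigmax _ _ (Ordinal M0)).
apply: (@le_trans _ _ (`|Dn N x z (Ordinal M0) f|%:E)); first by rewrite lee_fin.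
by apply: ereal_sup_ubound; exists f.
Qed.

Lemma max_Dn_le (z : {ffun K -> bool}) :
  max_Dn FF N x (uncurry_sel z) <=
  ((Num.sqrt N%:R)^-1 * sup_abs [set q : 'I_M * (r.-tuple S -> R) | FF q.2]
     (fun q => \sum_k ((z k)%:R - p) * column ev q k))%:E.
Proof.
apply: bigmax_le => [|m _]; first by rewrite leNye.
apply: ge_ereal_sup => _ [f Ff <-]; rewrite lee_fin /Dn normrM.
rewrite ger0_norm ?invr_ge0 ?sqrtr_ge0// ler_wpM2l ?invr_ge0 ?sqrtr_ge0//.
pose b := (\sum_k `|(z k)%:R - p| * F (subsample x k.1))%R.
have bP (q : 'I_M * (r.-tuple S -> R)) : FF q.2 ->
    (`|\sum_k ((z k)%:R - p) * column ev q k| <= b)%R.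
  move=> Fq; apply: (le_trans (ler_norm_sum _ _ _)); apply: ler_sum => k _.
  rewrite normrM ler_wpM2l// /column; case: eqP => _; rewrite ?mul1r; first exact: FFF.
  by rewrite mul0r normr0.
apply: le_trans (@sup_abs_ub _ _ [set q : 'I_M * (r.-tuple S -> R) | FF q.2]
  (fun q => \sum_k ((z k)%:R - p) * column ev q k)%R b (m, f) bP Ff).
by rewrite sum_column.
Qed.

Lemma mean_sqr_bnd f : FF f -> (#|{: I}|%:R^-1 * \sum_(i : I) f (subsample x i) ^+ 2 <=
   #|{: I}|%:R^-1 * \sum_(i : I) F (subsample x i) ^+ 2)%R.
Proof.
move=> Ff; rewrite ler_wpM2l ?invr_ge0//; apply: ler_sum => i _.
by rewrite -real_normK ?num_real// ler_pXn2r ?nnegrE//; exact: FFF.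
Qed.

Lemma sup_mean_sqr_ge0 : 0 <= sup_mean_sqr FF x.
Proof.
have [f Ff] := FF0.
apply: (@le_trans _ _ (#|{: I}|%:R^-1 * \sum_(i : I) f (subsample x i) ^+ 2)%:E).
  by rewrite lee_fin mulr_ge0 ?invr_ge0//; apply: sumr_ge0 => i _; exact: sqr_ge0.
by apply: ereal_sup_ubound; exists f.
Qed.

Lemma sup_mean_sqr_fin : sup_mean_sqr FF x \is a fin_num.
Proof.
rewrite ge0_fin_numE ?sup_mean_sqr_ge0//.
apply: le_lt_trans (ltry (#|{: I}|%:R^-1 * \sum_(i : I) F (subsample x i) ^+ 2)%R).
by apply: ge_ereal_sup => _ [f Ff <-]; rewrite lee_fin mean_sqr_bnd.
Qed.

(** The relevant probability puts equal mass on each selected pair (observation,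
group); the factor [s], the number of selected pairs, cancels on both sides. *)
Let cover (z : {ffun K -> bool}) :
  (0 < env2 (fun i => F (subsample x i)) z)%R ->
  forall eps : R, (0 < eps)%R ->
  exists m (c : 'I_m -> r.-tuple S -> R), [/\ forall i, FF (c i),
    forall f, FF f -> exists i, (dist2 ev z f (c i) <=
       eps ^+ 2 * env2 (fun i => F (subsample x i)) z)%R
    & (Num.sqrt (1 + ln m%:R) <= fine (entropy FF F eps))%R].
Proof.
move=> env0 eps eps0.
pose s := (\sum_(k : K) (z k)%:R : R)%R.
have s0 : (0 < s)%R.
  rewrite lt_def; apply/andP; split; last by apply: sumr_ge0.
  apply/negP; rewrite psumr_eq0// => /allP zk0; move: env0.
  rewrite /env2 big1 ?ltxx// => k _.
  by have /eqP-> := zk0 k (mem_index_enum _); rewrite mul0r.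
have := @entropy_cover _ _ _ FF F {: K} (fun k => (z k)%:R / s)%R
  (fun k => subsample x k.1) eps mFF mF _ _ eps0 FF0 (entropy_fin delta0 Joo eps0).
case.
- by move=> k; rewrite divr_ge0// ltW.
- by rewrite -mulr_suml divff// gt_eqF.
move=> m [c [cF c_cover c_card]]; exists m, c; split => // f Ff.
have [i ci] := c_cover f Ff; exists i.
have scale (g : K -> R) : (s^-1 * (\sum_k (z k)%:R * g k) = \sum_k (z k)%:R / s * g k)%R.
  by rewrite mulr_sumr; apply: eq_bigr => k _; rewrite mulrA [(s^-1 * _)%R]mulrC.
rewrite -(ler_pM2l (x := s^-1)) ?invr_gt0// [leRHS]mulrCA.
by rewrite /dist2 /env2 !scale.
Qed.

Lemma mean_max_Dn_le :
  \sum_(z : {ffun K -> bool}) (bern_weight p z)%:E * max_Dn FF N x (uncurry_sel z) <=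
  (200 ^+ 2 * (Num.sqrt (ln (2 * M%:R)) * fine (Jbar FF F delta) *
      Num.sqrt (M%:R * (#|{: I}|%:R^-1 * \sum_(i : I) F (subsample x i) ^+ 2)) +
    Num.sqrt (ln (2 * M%:R)) ^+ 2 *
      Num.sqrt (bern_mean p (fun z : {ffun K -> bool} => max_ZF F x (uncurry_sel z) ^+ 2)) *
      (Num.sqrt N%:R)^-1 * (fine (Jbar FF F delta) ^+ 2 / delta ^+ 2) +
    Num.sqrt (fine (sup_mean_sqr FF x)) * Num.sqrt (ln (2 * M%:R)) *
      (fine (Jbar FF F delta) / delta)))%:E.
Proof.
have p01 := samp_prob01.
have mono y y' : (0 < y)%R -> (y <= y')%R ->
    (fine (entropy FF F y') <= fine (entropy FF F y))%R.
  exact: (fine_entropy_mono delta0 Joo).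
have sumJ := entropy_dyadic_sum delta0 Joo.
have J0 : (0 <= fine (Jbar FF F delta))%R by rewrite fine_ge0// Jbar_ge0.
have DeltaP f : FF f -> (#|{: I}|%:R^-1 * \sum_i ev f i ^+ 2 <= fine (sup_mean_sqr FF x))%R.
  move=> Ff; rewrite -lee_fin fineK ?sup_mean_sqr_fin//.
  by apply: ereal_sup_ubound; exists f.
have := conditional_bound M0 N0 NI FF0 (fun f i Ff => FFF Ff (subsample x i)) J0 delta0
   DeltaP mono sumJ cover.
rewrite -lee_fin; apply: le_trans.
rewrite /bern_mean mulr_sumr -sumEFin; apply: lee_sum => z _.
rewrite mulrCA EFinM lee_wpmul2l ?lee_fin ?bern_weight_ge0//.
exact: max_Dn_le.
Qed.

End fixed_data.

(** * Moments of the envelope over the selected observations *)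
Section lyapunov.
Context d (T : measurableType d) (R : realType) (Pr : probability T R).

(** Hoelder's inequality for [`|f| `^ p] and the constant [1]. *)
Lemma Lnorm_le_exponent (f : T -> R) (p q : R) : measurable_fun setT f ->
  (0 < p <= q)%R -> 'N[Pr]_p%:E [EFin \o f] <= 'N[Pr]_q%:E [EFin \o f].
Proof.
move=> mf /andP[p0]; rewrite le_eqVlt => /predU1P[->//|pq].
have q0 : (0 < q)%R by exact: lt_trans pq.
pose s := (q / p)%R; pose s' := (1 - s^-1)^-1%R.
have s0 : (0 < s)%R by rewrite divr_gt0.
have s'0 : (0 < s')%R.
  by rewrite invr_gt0 subr_gt0 invf_lt1// /s ltr_pdivlMr// mul1r.
have ss' : (s^-1 + s'^-1 = 1)%R by rewrite /s' invrK addrC subrK.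
have mfp : measurable_fun setT (fun x => `|f x| `^ p)%R.
  apply: (@measurableT_comp _ _ _ _ _ _ (@powR R ^~ p)) => //.
  exact: measurableT_comp.
have := hoelder Pr mfp (measurable_cst (1%R : R)) s0 s'0 ss'.
rewrite Lnorm1 Lnorm_cst1 [X in _ * (X `^ _)](_ : _ = 1); last exact: probability_setT.
rewrite poweR1r mule1.
rewrite (eq_integral (fun x => `|(EFin \o f) x| `^ p)); last first.
  by move=> x _; rewrite /= mulr1 ger0_norm// powR_ge0.
set Ip := \int[_]_x _ => h.
rewrite unlock -/Ip.
have Ip0 : 0 <= Ip by apply: integral_ge0 => x _; exact: poweR_ge0.
rewrite (_ : q^-1 = s^-1 * p^-1)%R; last by rewrite /s; field; rewrite !gt_eqF.
rewrite poweRrM; apply: gt0_ler_poweR.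
- by rewrite invr_ge0 ltW.
- by rewrite in_itv/= Ip0 leey.
- by rewrite in_itv/= poweR_ge0 leey.
rewrite (eq_integral (fun x => `|(EFin \o (fun x => `|f x| `^ p)%R) x| `^ s)).
  by move: h; rewrite unlock.
move=> x _; rewrite /= (ger0_norm (powR_ge0 _ _)) -powRrM.
by rewrite /s mulrCA divff ?mulr1// gt_eqF.
Qed.

Lemma integral_sqrt_le (h : T -> R) : measurable_fun setT h -> (forall x, (0 <= h x)%R) ->
  \int[Pr]_x (Num.sqrt (h x))%:E <= sqrte (\int[Pr]_x (h x)%:E).
Proof.
move=> mh h0; have ms : measurable_fun setT (fun x => Num.sqrt (h x)).
  by apply: measurableT_comp => //; apply: continuous_measurable_fun; exact: sqrt_continuous.
have := @Lnorm_le_exponent _ 1%R 2%R ms; rewrite Lnorm1 Lnorm2E.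
rewrite (eq_integral (fun x => (Num.sqrt (h x))%:E)); last first.
  by move=> x _; rewrite /= ger0_norm// sqrtr_ge0.
rewrite [in X in sqrte X](eq_integral (fun x => (h x)%:E)); last first.
  by move=> x _; rewrite sqr_sqrtr.
by apply; lra.
Qed.

End lyapunov.

Lemma measurable_bigmax d (T : measurableType d) (R : realType) (J : finType)
    (g : J -> T -> R) :
  (forall j, measurable_fun setT (g j)) ->
  measurable_fun setT (fun x => \big[Num.max/0]_j g j x)%R.
Proof.
move=> mg; rewrite /index_enum; elim: (locked_with _ _) => [|j s ih].
  by under eq_fun do rewrite big_nil; exact: measurable_cst.
by under eq_fun do rewrite big_cons; exact: measurable_maxr.
Qed.

Section max_ZF_facts.
Context d (S : measurableType d) (R : realType) (r n M : nat).
Variables (F : r.-tuple S -> R).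
Hypothesis mF : measurable_fun setT F.
Hypothesis F0 : forall y, (0 <= F y)%R.
Notation I := (incr_tuple n r).

Lemma measurable_subsample (i : I) :
  measurable_fun setT (fun x : n.-tuple S => subsample x i).
Proof.
apply/measurable_fun_tnthP => k.
rewrite (_ : _ \o _ = fun x : n.-tuple S => tnth x (tnth (val i) k)).
  exact: measurable_tnth.
by apply/funext => x /=; rewrite tnth_mktuple.
Qed.

Lemma measurable_max_ZF (z : I -> 'I_M -> bool) :
  measurable_fun setT (fun x : n.-tuple S => max_ZF F x z).
Proof.
do 2 apply: measurable_bigmax => ?.
apply: measurable_funM; first exact: measurable_cst.
exact: (measurableT_comp mF (measurable_subsample _)).
Qed.

Lemma max_ZF_ge0 (x : n.-tuple S) (z : I -> 'I_M -> bool) : (0 <= max_ZF F x z)%R.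
Proof. exact: bigmax_ge_id. Qed.

(** A maximum of nonnegative numbers is one of them or the default value [0]. *)
Lemma max_ZF_powR (q : R) (x : n.-tuple S) (z : I -> 'I_M -> bool) : (0 < q)%R ->
  (max_ZF F x z `^ q <= \sum_(k : I * 'I_M) (z k.1 k.2)%:R * F (subsample x k.1) `^ q)%R.
Proof.
move=> q0; set s := (\sum_(k : _) _)%R.
have s0 : (0 <= s)%R by apply: sumr_ge0 => k _; rewrite mulr_ge0// powR_ge0.
pose P y : Prop := (y `^ q <= s)%R.
have Pmax y y' : P y -> P y' -> P (Num.max y y').
  by move=> Py Py'; rewrite /Order.max; case: ifP.
have P0 : P 0%R by rewrite /P powR0// gt_eqF.
apply: (big_ind P) => // i _; apply: (big_ind P) => // m _.
rewrite /P; have [zim|] := boolP (z i m); last by rewrite mul0r powR0// gt_eqF.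
rewrite mul1r /s (bigD1 (i, m))//= zim mul1r lerDl.
by apply: sumr_ge0 => k _; rewrite mulr_ge0// powR_ge0.
Qed.

End max_ZF_facts.

Section random_process.
Context d d' (S : measurableType d) (Omega : measurableType d') (R : realType).
Variables (P : probability S R) (Pr : probability Omega R) (r n M N : nat).
Variables (F : r.-tuple S -> R).
Variables (X : 'I_n -> {RV Pr >-> S}) (Z : incr_tuple n r -> 'I_M -> {RV Pr >-> bool}).
Notation I := (incr_tuple n r).
Notation K := (I * 'I_M)%type.
Notation p := (samp_prob R n r N).
Hypothesis M0 : (0 < M)%N.
Hypothesis N0 : (0 < N)%N.
Hypothesis NI : (N <= #|{: I}|)%N.
Hypothesis mF : measurable_fun setT F.
Hypothesis F0 : forall y, (0 <= F y)%R.
Hypothesis XP : forall i A, measurable A -> distribution Pr (X i) A = P A.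
Hypothesis Xind : mutually_independent X.
Hypothesis Zlaw : forall i m A, distribution Pr (Z i m) A = bernoulli_prob p A.
Hypothesis Zind : mutually_independent (fun im : K => Z im.1 im.2).
Hypothesis XZind : independent_families X (fun im : K => Z im.1 im.2).

Notation Xs := (sample X).
Notation Zs := (fun w i m => Z i m w : bool).

Let measurable_random_subsample (i : I) :
  measurable_fun setT (fun w => subsample (Xs w) i).
Proof. exact: (measurableT_comp (measurable_subsample i) (measurable_sample X)). Qed.

Lemma subsample_law (i : I) A : measurable A ->
  Pr ((fun w => subsample (Xs w) i) @^-1` A) = power_prob P r A.
Proof.
move=> mA; apply: (sample_law _ XP Xind mA).
case: i => t /= /(sorted_uniq ltn_trans ltnn)/map_uniq/tuple_uniqP tinj k k' /tinj.
exact.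
Qed.

Lemma integral_subsample (i : I) (h : r.-tuple S -> \bar R) :
  measurable_fun setT h -> (forall y, 0 <= h y) ->
  \int[Pr]_w h (subsample (Xs w) i) = \int[power_prob P r]_y h y.
Proof.
move=> mh h0; have h0' : {in setT, forall y, 0 <= h y} by [].
have e := ge0_integral_pushforward (measurable_random_subsample i) Pr measurableT mh h0'.
rewrite preimage_setT in e; rewrite -[LHS]e.
by apply: eq_measure_integral => A mA _; exact: subsample_law.
Qed.

Lemma ae_subsample (i : I) (Q : r.-tuple S -> Prop) :
  (\forall y \ae power_prob P r, Q y) -> \forall w \ae Pr, Q (subsample (Xs w) i).
Proof.
move=> [B [mB PB QB]]; exists ((fun w => subsample (Xs w) i) @^-1` B); split.
- by rewrite -[X in measurable X]setTI; exact: measurable_random_subsample.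
- by rewrite subsample_law.
- by move=> w /= nQ; exact: QB.
Qed.

Lemma integral_conditioning_sel (H : (I -> 'I_M -> bool) -> n.-tuple S -> \bar R) :
  (forall z, measurable_fun setT (H z)) -> (forall z x, 0 <= H z x) ->
  \int[Pr]_w H (Zs w) (Xs w) =
  \int[Pr]_w \sum_(z : {ffun K -> bool}) (bern_weight p z)%:E * H (uncurry_sel z) (Xs w).
Proof.
move=> mH H0.
rewrite -(integral_conditioning (X := X) (Z := fun im : K => Z im.1 im.2) (p := p)
  _ _ _ _ (H := fun z x => H (uncurry_sel z) x))//.
  apply: eq_integral => w _; congr (H _ _).
  by apply/funext => i; apply/funext => m; rewrite /uncurry_sel ffunE.
exact: samp_prob01.
Qed.

(** A union bound for moments: each of the [#|K|] summands is selected with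
probability [p], and [#|K|%:R * p = M%:R * N%:R]. *)
Lemma integral_max_ZF_powR (q : R) : (0 < q)%R ->
  \int[Pr]_w (max_ZF F (Xs w) (Zs w) `^ q)%:E <=
  (M%:R * N%:R)%:E * \int[power_prob P r]_y (F y `^ q)%:E.
Proof.
move=> q0.
have mq d0 (T : measurableType d0) (g : T -> R) :
    measurable_fun setT g -> measurable_fun setT (fun y => g y `^ q)%R.
  by move=> mg; apply: (@measurableT_comp _ _ _ _ _ _ (@powR R ^~ q)).
rewrite (@integral_conditioning_sel (fun z x => (max_ZF F x z `^ q)%:E)); last 2 first.
- by move=> z; apply/measurable_EFinP; apply: mq; exact: measurable_max_ZF.
- by move=> z x; rewrite lee_fin powR_ge0.
have p01 := samp_prob01 R N0 NI.
have mFs (k : K) : measurable_fun setT (fun w => (F (subsample (Xs w) k.1) `^ q)%:E).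
  apply/measurable_EFinP; apply: mq; apply: (measurableT_comp mF).
  exact: (measurableT_comp (measurable_subsample k.1) (measurable_sample X)).
have Fq0 y : (0 <= F y `^ q)%R by exact: powR_ge0.
apply: (@le_trans _ _ (\int[Pr]_w \sum_(k : K) p%:E * (F (subsample (Xs w) k.1) `^ q)%:E)).
  apply: ge0_le_integral => //.
  - move=> w _; apply: sume_ge0 => z _.
    by rewrite mule_ge0 ?lee_fin ?bern_weight_ge0 ?powR_ge0.
  - apply: emeasurable_sum => z; apply: measurable_funeM; apply/measurable_EFinP; apply: mq.
    exact: (measurableT_comp (measurable_max_ZF mF (uncurry_sel z)) (measurable_sample X)).
  - by apply: emeasurable_sum => k; exact: measurable_funeM.
  move=> w _; under eq_bigr do rewrite -EFinM; rewrite sumEFin.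
  under [leRHS]eq_bigr do rewrite -EFinM; rewrite sumEFin lee_fin.
  apply: (@le_trans _ _ (bern_mean p (fun z : {ffun K -> bool} =>
      \sum_(k : K) F (subsample (Xs w) k.1) `^ q * (z k)%:R)%R)).
    apply: ler_bern_mean => // z; apply: (le_trans (max_ZF_powR _ _ _ q0)).
    by apply: ler_sum => -[i m] _; rewrite mulrC.
  rewrite bern_mean_sum; apply: ler_sum => k _.
  by rewrite bern_meanZ bern_mean_coord mulrC.
rewrite ge0_integral_sum//; last 2 first.
- by move=> k; exact: measurable_funeM.
- by move=> k w _; rewrite mule_ge0// lee_fin; case/andP: p01.
rewrite (eq_bigr (fun=> p%:E * \int[power_prob P r]_y (F y `^ q)%:E)); last first.
  move=> k _; rewrite ge0_integralZl//; last 2 first.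
  - by move=> w _; rewrite lee_fin.
  - by rewrite lee_fin; case/andP: p01.
  rewrite (@integral_subsample k.1 (fun y => (F y `^ q)%:E))//.
  by apply/measurable_EFinP; exact: mq.
rewrite -ge0_sume_distrl; last by move=> k _; rewrite lee_fin; case/andP: p01.
rewrite sumEFin sumr_const card_prod card_ord le_eqVlt; apply/orP; left; apply/eqP.
congr (_%:E * _); rewrite -[(_ *+ _)%R]mulr_natr natrM /samp_prob; field.
by rewrite pnatr_eq0 -lt0n (leq_trans N0).
Qed.

Lemma measurable_random_max_ZF : measurable_fun setT (fun w => max_ZF F (Xs w) (Zs w)).
Proof.
apply: measurable_bigmax => i; apply: measurable_bigmax => m.
apply: measurable_funM.
  have mb : measurable_fun setT (fun b : bool => b%:R : R) by move=> _ Y _.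
  exact: (measurableT_comp mb (measurable_funPT (Z i m))).
apply: (measurableT_comp mF).
exact: (measurableT_comp (measurable_subsample i) (measurable_sample X)).
Qed.

(** For a finite exponent this combines [Lnorm_le_exponent] with
[integral_max_ZF_powR]. For the essential supremum,
the null set on which the envelope exceeds it pulls back to a null event for each
of the finitely many observations. *)
Lemma Lnorm_max_ZF_le (q : \bar R) : 2%:E <= q ->
  'N[Pr]_2%:E [(fun w => (max_ZF F (Xs w) (Zs w))%:E)] <=
  (let q' : R := if q is q0%:E then q0^-1%R else 0%R in
   (M%:R `^ q')%:E * (N%:R `^ q')%:E * 'N[power_prob P r]_q [EFin \o F]).
Proof.
have mT := measurable_random_max_ZF.
case: q => [q|_|//] /=.
  rewrite lee_fin => q2; have q0 : (0 < q)%R by lra.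
  have q02 : (0 < (2 : R) <= q)%R by apply/andP; split => //; lra.
  apply: (le_trans (Lnorm_le_exponent Pr mT q02)).
  rewrite unlock -!poweR_EFin -!poweRM ?lee_fin//; last first.
    by apply: integral_ge0 => y _; exact: poweR_ge0.
  apply: gt0_ler_poweR.
  - by rewrite invr_ge0 ltW.
  - by rewrite in_itv/= leey andbT; apply: integral_ge0 => y _; rewrite lee_fin powR_ge0.
  - rewrite in_itv/= leey andbT mule_ge0//; apply: integral_ge0 => y _.
    by rewrite lee_fin powR_ge0.
  rewrite (eq_integral (fun w => (max_ZF F (Xs w) (Zs w) `^ q)%:E)); last first.
    by move=> w _; rewrite /= ger0_norm// max_ZF_ge0.
  rewrite [X in _ <= _ * X](eq_integral (fun y => (F y `^ q)%:E)).
    by rewrite -EFinM; exact: integral_max_ZF_powR.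
  by move=> y _; rewrite /= ger0_norm.
rewrite !powRr0 !mul1e.
set b := 'N[_]_+oo [_].
have [b_fin|] := boolP (b \is a fin_num); last first.
  rewrite ge0_fin_numE ?Lnorm_ge0// ltey negbK => /eqP ->; exact: leey.
have b0 : (0 <= fine b)%R by rewrite fine_ge0// Lnorm_ge0.
have Fb (i : I) : \forall w \ae Pr, (F (subsample (Xs w) i) <= fine b)%R.
  apply: (@ae_subsample i (fun y => (F y <= fine b)%R)).
  have := @ess_sup_ge _ _ R (power_prob P r) (abse \o (EFin \o F)).
  apply: filterS => y /=; rewrite ger0_norm// -lee_fin fineK//.
  rewrite /b unlock; case: ifPn => //; rewrite [X in ~~ (0 < X)](_ : _ = 1).
    by rewrite lte01.
  exact: probability_setT.
have Tb : \forall w \ae Pr, ((max_ZF F (Xs w) (Zs w) ^+ 2)%:E <= (fine b ^+ 2)%:E).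
  have Fball : \forall w \ae Pr, forall i, (F (subsample (Xs w) i) <= fine b)%R.
    exact: (filter_forall _ Fb).
  apply: filterS Fball => w Fw.
  rewrite lee_fin ler_pXn2r ?nnegrE// ?max_ZF_ge0//.
  apply: bigmax_le => // i _; apply: bigmax_le => // m _.
  by case: (Z i m w); rewrite ?mul1r// mul0r.
rewrite Lnorm2E -[leRHS]gee0_abs ?Lnorm_ge0// -sqrte_sqr; apply: le_sqrte.
rewrite -/b -(fineK b_fin) -EFin_expe.
apply: (@le_trans _ _ (\int[Pr]_w (cst (fine b ^+ 2)%:E w))).
  apply: ae_ge0_le_integral => //.
  - by move=> w _; rewrite lee_fin sqr_ge0.
  - by apply/measurable_EFinP; exact: measurable_funX.
  - by move=> w _; rewrite lee_fin sqr_ge0.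
  - by apply: filterS Tb.
rewrite integral_cst// [X in _ * X](_ : _ = 1) ?mule1//.
exact: probability_setT.
Qed.

End random_process.

(** * Integration over the data *)
Section process_bound.
Context d d' (S : measurableType d) (Omega : measurableType d') (R : realType).
Variables (P : probability S R) (Pr : probability Omega R) (r n M N : nat).
Variables (FF : set (r.-tuple S -> R)) (F : r.-tuple S -> R).
Variables (X : 'I_n -> {RV Pr >-> S}) (Z : incr_tuple n r -> 'I_M -> {RV Pr >-> bool}).
Variable delta : R.
Notation I := (incr_tuple n r).
Notation K := (I * 'I_M)%type.
Notation p := (samp_prob R n r N).
Hypothesis M0 : (0 < M)%N.
Hypothesis N0 : (0 < N)%N.
Hypothesis NI : (N <= #|{: I}|)%N.
Hypothesis FF0 : FF !=set0.
Hypothesis mFF : forall f, FF f -> measurable_fun setT f.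
Hypothesis mF : measurable_fun setT F.
Hypothesis FFF : forall f, FF f -> forall y, (`|f y| <= F y)%R.
Hypothesis mDn : forall z : I -> 'I_M -> bool,
  measurable_fun setT (fun x : n.-tuple S => max_Dn FF N x z).
Hypothesis msup : measurable_fun setT (fun x : n.-tuple S => sup_mean_sqr FF x).
Hypothesis XP : forall i A, measurable A -> distribution Pr (X i) A = P A.
Hypothesis Xind : mutually_independent X.
Hypothesis Zlaw : forall i m A, distribution Pr (Z i m) A = bernoulli_prob p A.
Hypothesis Zind : mutually_independent (fun im : K => Z im.1 im.2).
Hypothesis XZind : independent_families X (fun im : K => Z im.1 im.2).
Hypothesis delta0 : (0 < delta)%R.
Hypothesis Joo : Jbar FF F delta < +oo.

Notation Xs := (sample X).
Notation Zs := (fun w i m => Z i m w : bool).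
Notation lam := (Num.sqrt (ln (2 * M%:R)) : R).
Notation J := (fine (Jbar FF F delta)).

(** The squares of the three functions of the data that occur in the bound for fixed
data. *)
Let env (w : Omega) : R :=
  (M%:R * (#|{: I}|%:R^-1 * \sum_(i : I) F (subsample (Xs w) i) ^+ 2))%R.
Let top (w : Omega) : R :=
  bern_mean p (fun z : {ffun K -> bool} => max_ZF F (Xs w) (uncurry_sel z) ^+ 2)%R.
Let rad (w : Omega) : R := fine (sup_mean_sqr FF (Xs w)).

Let mXs := measurable_sample X.
Let p01 := samp_prob01 R N0 NI.

Let I0 : (0 < #|{: I}|%:R :> R)%R.
Proof. by rewrite ltr0n (leq_trans N0). Qed.

Let mFs i : measurable_fun setT (fun w => F (subsample (Xs w) i) ^+ 2)%R.
Proof.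
apply: measurable_funX; apply: (measurableT_comp mF).
exact: (measurableT_comp (measurable_subsample i) mXs).
Qed.

Let menv : measurable_fun setT env.
Proof.
apply: measurable_funM; first exact: measurable_cst.
apply: measurable_funM; first exact: measurable_cst.
by apply: measurable_sum => i; exact: mFs.
Qed.

Let env0 w : (0 <= env w)%R.
Proof.
by rewrite !mulr_ge0 ?invr_ge0//; apply: sumr_ge0 => i _; exact: sqr_ge0.
Qed.

Let env_int : \int[Pr]_w (env w)%:E = M%:R%:E * \int[power_prob P r]_y (F y ^+ 2)%:E.
Proof.
have F20 y : 0 <= (F y ^+ 2)%:E by rewrite lee_fin sqr_ge0.
have mF2 : measurable_fun setT (fun y => (F y ^+ 2)%:E).
  by apply/measurable_EFinP; exact: measurable_funX.
transitivity (\int[Pr]_w ((M%:R * #|{: I}|%:R^-1)%:E *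
    \sum_(i : I) (F (subsample (Xs w) i) ^+ 2)%:E)).
  by apply: eq_integral => w _; rewrite sumEFin -EFinM /env mulrA.
have mFsE i : measurable_fun setT (fun w => (F (subsample (Xs w) i) ^+ 2)%:E).
  by apply/measurable_EFinP; exact: mFs.
have k0 : 0 <= (M%:R * #|{: I}|%:R^-1)%:E :> \bar R by rewrite lee_fin mulr_ge0// invr_ge0.
have sum0 w : 0 <= \sum_(i : I) (F (subsample (Xs w) i) ^+ 2)%:E by exact: sume_ge0.
rewrite ge0_integralZl//; last exact: emeasurable_sum.
rewrite ge0_integral_sum//.
rewrite (eq_bigr (fun=> 1 * \int[power_prob P r]_y (F y ^+ 2)%:E)); last first.
  by move=> i _; rewrite mul1e -(integral_subsample XP Xind i mF2).
rewrite -ge0_sume_distrl// muleA; congr (_ * _).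
rewrite sumEFin -EFinM sumr_const; congr EFin; field; exact: lt0r_neq0.
Qed.

Let mtop : measurable_fun setT top.
Proof.
apply: measurable_sum => z; apply: measurable_funM; first exact: measurable_cst.
apply: measurable_funX.
exact: (measurableT_comp (measurable_max_ZF mF (uncurry_sel z)) mXs).
Qed.

Let top0 w : (0 <= top w)%R.
Proof. by apply: bern_mean_ge0 => // z; exact: sqr_ge0. Qed.

Let top_int : sqrte (\int[Pr]_w (top w)%:E) =
  'N[Pr]_2%:E [(fun w => (max_ZF F (Xs w) (Zs w))%:E)].
Proof.
rewrite -[RHS]/('N[Pr]_2%:E [EFin \o (fun w => max_ZF F (Xs w) (Zs w))]) Lnorm2E.
rewrite (@integral_conditioning_sel _ _ _ _ _ _ _ _ _ _ _ _ N0 NI Zlaw Zind XZind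
  (fun z x => (max_ZF F x z ^+ 2)%:E)).
- congr sqrte; apply: eq_integral => w _; rewrite /top /bern_mean -sumEFin.
  by apply: eq_bigr.
- by move=> z; apply/measurable_EFinP/measurable_funX; exact: measurable_max_ZF.
- by move=> z x; rewrite lee_fin sqr_ge0.
Qed.

Let mrad : measurable_fun setT rad.
Proof. by apply: (measurableT_comp _ (measurableT_comp msup mXs)). Qed.

Let rad0 w : (0 <= rad w)%R.
Proof. by rewrite fine_ge0// sup_mean_sqr_ge0. Qed.

Let rad_int : \int[Pr]_w (rad w)%:E = \int[Pr]_w sup_mean_sqr FF (Xs w).
Proof. by apply: eq_integral => w _; rewrite fineK// (sup_mean_sqr_fin _ FF0 FFF). Qed.

Lemma integral_max_Dn_le :
  \int[Pr]_w max_Dn FF N (Xs w) (Zs w) <=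
  (200 ^+ 2)%:E *
    ((lam * J)%:E * sqrte (M%:R%:E * \int[power_prob P r]_y (F y ^+ 2)%:E) +
     (lam ^+ 2 * (Num.sqrt N%:R)^-1 * (J ^+ 2 / delta ^+ 2))%:E *
       'N[Pr]_2%:E [(fun w => (max_ZF F (Xs w) (Zs w))%:E)] +
     (lam * (J / delta))%:E * sqrte (\int[Pr]_w sup_mean_sqr FF (Xs w))).
Proof.
have J0 : (0 <= J)%R by rewrite fine_ge0// Jbar_ge0.
have lam0 : (0 <= lam)%R by exact: sqrtr_ge0.
set c1 := (lam * J)%R; set c2 := (_ * _ * (J ^+ 2 / _))%R; set c3 := (lam * _)%R.
have c10 : (0 <= c1)%R by exact: mulr_ge0.
have c20 : (0 <= c2)%R.
  by rewrite !mulr_ge0 ?sqr_ge0 ?invr_ge0 ?sqrtr_ge0 ?sqr_ge0.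
have c30 : (0 <= c3)%R by rewrite !mulr_ge0// invr_ge0 ltW.
have msq (h : Omega -> R) : measurable_fun setT h ->
    measurable_fun setT (fun w => (Num.sqrt (h w))%:E).
  move=> mh; apply/measurable_EFinP; apply: measurableT_comp => //.
  by apply: continuous_measurable_fun; exact: sqrt_continuous.
have sq0 (h : Omega -> R) w : 0 <= (Num.sqrt (h w))%:E by rewrite lee_fin sqrtr_ge0.
rewrite (@integral_conditioning_sel _ _ _ _ _ _ _ _ _ _ _ _ N0 NI Zlaw Zind XZind
  (fun z x => max_Dn FF N x z))//; last by move=> z x; exact: max_Dn_ge0.
apply: (@le_trans _ _ (\int[Pr]_w ((200 ^+ 2)%:E * (c1%:E * (Num.sqrt (env w))%:E +
   c2%:E * (Num.sqrt (top w))%:E + c3%:E * (Num.sqrt (rad w))%:E)))).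
  apply: ge0_le_integral => //.
  - move=> w _; apply: sume_ge0 => z _.
    by rewrite mule_ge0 ?lee_fin ?bern_weight_ge0// max_Dn_ge0.
  - apply: emeasurable_sum => z; apply: measurable_funeM.
    exact: (measurableT_comp (mDn (uncurry_sel z)) mXs).
  - apply: measurable_funeM; apply: emeasurable_funD; first apply: emeasurable_funD.
    + by apply: measurable_funeM; exact: msq.
    + by apply: measurable_funeM; exact: msq.
    + by apply: measurable_funeM; exact: msq.
  move=> w _; apply: (le_trans (mean_max_Dn_le (Xs w) M0 N0 NI FF0 mFF mF FFF delta0 Joo)).
  rewrite [leRHS](_ : _ = (200 ^+ 2 * (c1 * Num.sqrt (env w) + c2 * Num.sqrt (top w) +
    c3 * Num.sqrt (rad w)))%:E)// lee_fin ler_pM2l ?exprn_gt0//.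
  rewrite -/(env w) -/(top w) -/(rad w) le_eqVlt; apply/orP; left; apply/eqP.
  by rewrite /c1 /c2 /c3; ring.
have t10 w : 0 <= c1%:E * (Num.sqrt (env w))%:E by rewrite mule_ge0.
have t20 w : 0 <= c2%:E * (Num.sqrt (top w))%:E by rewrite mule_ge0.
have t30 w : 0 <= c3%:E * (Num.sqrt (rad w))%:E by rewrite mule_ge0.
have m1 : measurable_fun setT (fun w => c1%:E * (Num.sqrt (env w))%:E).
  by apply: measurable_funeM; exact: msq.
have m2 : measurable_fun setT (fun w => c2%:E * (Num.sqrt (top w))%:E).
  by apply: measurable_funeM; exact: msq.
have m3 : measurable_fun setT (fun w => c3%:E * (Num.sqrt (rad w))%:E).
  by apply: measurable_funeM; exact: msq.
have m12 := emeasurable_funD m1 m2; have m123 := emeasurable_funD m12 m3.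
have t120 w : 0 <= c1%:E * (Num.sqrt (env w))%:E + c2%:E * (Num.sqrt (top w))%:E.
  exact: adde_ge0.
rewrite (ge0_integralZl _ measurableT m123); last 2 first.
- by move=> w _; exact: adde_ge0.
- by rewrite lee_fin exprn_ge0.
rewrite lee_pmul2l ?lte_fin ?exprn_gt0//.
rewrite (ge0_integralD _ measurableT _ m12 _ m3)//.
rewrite (ge0_integralD _ measurableT _ m1 _ m2)//.
rewrite (ge0_integralZl _ measurableT (msq env menv))//.
rewrite (ge0_integralZl _ measurableT (msq top mtop))//.
rewrite (ge0_integralZl _ measurableT (msq rad mrad))//.
have i1 := integral_sqrt_le Pr menv env0.
have i2 := integral_sqrt_le Pr mtop top0.
have i3 := integral_sqrt_le Pr mrad rad0.
rewrite env_int in i1; rewrite top_int in i2; rewrite rad_int in i3.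
by apply: leeD; [apply: leeD|]; rewrite lee_wpmul2l// lee_fin.
Qed.

End process_bound.

Theorem theoremA1 (R : realType) :
  exists C : R, (0 < C)%R /\
  forall (d d' : measure_display) (S : measurableType d)
    (Omega : measurableType d') (P : probability S R)
    (Pr : probability Omega R) (r n M N : nat)
    (FF : set (r.-tuple S -> R)) (F : r.-tuple S -> R)
    (X : 'I_n -> {RV Pr >-> S})
    (Z : incr_tuple n r -> 'I_M -> {RV Pr >-> bool})
    (sigma : R),
  (2 <= r)%N -> (1 <= M)%N -> (0 < N <= #|{: incr_tuple n r}|)%N ->
  (forall f, FF f -> symmetric_fun f /\ measurable_fun setT f) ->
  measurable_fun setT F -> (forall x, (0 <= F x)%R) ->
  (forall f, FF f -> forall x, (`|f x| <= F x)%R) ->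
  0 < \int[power_prob P r]_x (F x ^+ 2)%:E < +oo ->
  (* the suprema over [FF] whose expectations are taken are measurable *)
  (forall z : incr_tuple n r -> 'I_M -> bool,
     measurable_fun setT (fun x : n.-tuple S => max_Dn FF N x z)) ->
  measurable_fun setT (fun x : n.-tuple S => sup_mean_sqr FF x) ->
  (forall i A, measurable A -> distribution Pr (X i) A = P A) ->
  mutually_independent X ->
  (forall i m A, distribution Pr (Z i m) A =
                 bernoulli_prob (samp_prob R n r N) A) ->
  mutually_independent (fun im : incr_tuple n r * 'I_M => Z im.1 im.2) ->
  independent_families X (fun im : incr_tuple n r * 'I_M => Z im.1 im.2) ->
  (0 < sigma)%R ->
  ereal_sup [set 'N[power_prob P r]_2%:E [EFin \o f] | f in FF] <= sigma%:E ->
  sigma%:E <= 'N[power_prob P r]_2%:E [EFin \o F] ->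
  let Xs (w : Omega) : n.-tuple S := [tuple X i w | i < n] in
  let Zs (w : Omega) (i : incr_tuple n r) (m : 'I_M) : bool := Z i m w in
  let normF (q : \bar R) : \bar R := 'N[power_prob P r]_q [EFin \o F] in
  let delta : R := (sigma / (Num.sqrt M%:R * fine (normF 2%:E)))%R in
  let Delta : \bar R := \int[Pr]_w sup_mean_sqr FF (Xs w) in
  let normT : \bar R := 'N[Pr]_2%:E [(fun w => (max_ZF F (Xs w) (Zs w))%:E)] in
  let log2M : R := ln (2 * M%:R)%R in
  let J : R -> \bar R := Jbar FF F in
  [/\ C^-1%:E * \int[Pr]_w max_Dn FF N (Xs w) (Zs w) <=
        (Num.sqrt (M%:R * log2M))%:E * J delta * normF 2%:E +
        log2M%:E * normT * ((Num.sqrt N%:R)^-1)%:E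
          * (J delta ^+ 2 * ((delta ^+ 2)^-1)%:E) +
        sqrte (Delta * log2M%:E) * (J delta * (delta^-1)%:E),
      (forall q : \bar R, 2%:E <= q ->
         let q' : R := if q is q0%:E then q0^-1%R else 0%R in
         normT <= (M%:R `^ q')%:E * (N%:R `^ q')%:E * normF q)
    & (forall A nu : R,
         (Num.max (expR 1) (expR (2 * (r%:R - 1)) / 16) <= A)%R ->
         (1 <= nu)%R -> VC_type FF F A nu ->
         forall tau : R, (0 < tau <= 1)%R ->
           J tau <= (C * tau * Num.sqrt (nu * ln (A / tau)))%:E)].
Proof.
exists (200 ^+ 2)%R; split; first exact: exprn_gt0.
move=> d d' S Omega P Pr r n M N FF F X Z sigma r2 M1 /andP[N0 NI] mFF mF F0 FFF.
move=> /andP[F2_gt0 F2_fin] mDn msup XP Xind Zlaw Zind XZind sigma0 _ _.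
move=> Xs Zs normF delta Delta normT log2M J; split; last 2 first.
- by move=> q q2; exact: (Lnorm_max_ZF_le N0 NI mF F0 XP Xind Zlaw Zind XZind q2).
- move=> A nu; rewrite ge_max => /andP[eA _] nu1 VC tau tau01.
  apply: (le_trans (Jbar_VC eA nu1 VC tau01)); rewrite lee_fin.
  case/andP: tau01 => tau0 _.
  rewrite -(mulrA 4%R) -(mulrA (200 ^+ 2)%R); apply: ler_wpM2r.
    by rewrite mulr_ge0 ?sqrtr_ge0// ltW.
  by rewrite expr2; lra.
(* For an empty class the suprema are [-oo]. *)
have [->|/set0P FF0] := eqVneq FF set0.
  rewrite (eq_integral (cst -oo)); last first.
    move=> w _; apply/eqP; rewrite -leeNy_eq; apply: bigmax_le => // m _.
    by rewrite /sup_norm image_set0 ereal_sup0.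
  rewrite integral_cst// [X in _ * (_ * X)](_ : _ = 1); last exact: probability_setT.
  by rewrite mule1 mulrNy gtr0_sg ?mul1e ?leNye// invr_gt0 exprn_gt0.
have M0' : (0 < M%:R :> R)%R by rewrite ltr0n.
have log2M0 : (0 < log2M)%R.
  by rewrite ln_gt0// (lt_le_trans (ltr1n R 2 : _)) ?ler_peMr ?ler1n.
have normFE : normF 2%:E = sqrte (\int[power_prob P r]_x (F x ^+ 2)%:E) by exact: Lnorm2E.
have normF_fin : normF 2%:E \is a fin_num.
  by rewrite normFE sqrte_fin_num ?ge0_fin_numE// ltW.
have normF_gt0 : 0 < normF 2%:E.
  rewrite normFE; case: (\int[_]_x _) F2_gt0 => [y| |]//=.
  by rewrite !lte_fin sqrtr_gt0.
have delta0 : (0 < delta)%R.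
  rewrite divr_gt0// mulr_gt0 ?sqrtr_gt0// fine_gt0// normF_gt0/=.
  by rewrite ltey_eq normF_fin.
have J_ge0 : 0 <= J delta by exact: Jbar_ge0.
have Delta_ge0 : 0 <= Delta by apply: integral_ge0 => w _; exact: sup_mean_sqr_ge0.
(* If the entropy integral is infinite, so is the first term of the bound. *)
have [Jy|J_neqy] := eqVneq (J delta) +oo.
  have second_ge0 : 0 <= log2M%:E * normT * ((Num.sqrt N%:R)^-1)%:E *
      (J delta ^+ 2 * ((delta ^+ 2)^-1)%:E).
    apply: mule_ge0; last first.
      by apply: mule_ge0; [exact: expe_ge0|rewrite lee_fin invr_ge0 sqr_ge0].
    apply: mule_ge0; last by rewrite lee_fin invr_ge0 sqrtr_ge0.
    by apply: mule_ge0; [rewrite lee_fin ltW|exact: Lnorm_ge0].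
  have third_ge0 : 0 <= sqrte (Delta * log2M%:E) * (J delta * (delta^-1)%:E).
    by rewrite !mule_ge0 ?sqrte_ge0// lee_fin invr_ge0 ltW.
  rewrite [X in _ <= X + _ + _](_ : _ = +oo); last first.
    rewrite Jy gt0_muley ?lte_fin ?sqrtr_gt0 ?mulr_gt0//.
    by rewrite gt0_mulye.
  rewrite addye; last by rewrite gt_eqF// (lt_le_trans _ second_ge0) ?ltNy0.
  rewrite addye; last by rewrite gt_eqF// (lt_le_trans _ third_ge0) ?ltNy0.
  exact: leey.
have J_fin : J delta < +oo by rewrite ltey.
have JE : J delta = (fine (J delta))%:E by rewrite fineK// ge0_fin_numE.
rewrite lee_pdivrMl ?exprn_gt0//.
have mFF' f : FF f -> measurable_fun setT f by move=> /mFF[].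
have main := integral_max_Dn_le M1 N0 NI FF0 mFF' mF FFF mDn msup XP Xind Zlaw
  Zind XZind delta0 J_fin.
apply: le_trans; first exact: main.
rewrite lee_pmul2l ?lte_fin ?exprn_gt0// -/log2M -/(J delta).
have lam2 : (Num.sqrt log2M ^+ 2 = log2M)%R by rewrite sqr_sqrtr// ltW.
rewrite le_eqVlt; apply/orP; left; apply/eqP; congr (_ + _ + _).
- rewrite sqrteM ?lee_fin// -normFE muleA; congr (_ * _).
  by rewrite [in RHS]JE -!EFinM; congr EFin; rewrite sqrtrM ?(ltW M0')//; ring.
- rewrite lam2 [in RHS]JE -EFin_expe -EFinM -[RHS]muleA -EFinM.
  by rewrite -mulrA EFinM muleAC.
- rewrite sqrteM// [in RHS]JE -EFinM -muleA -[sqrte log2M%:E]/((Num.sqrt log2M)%:E).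
  by rewrite -EFinM muleC.
Qed.
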